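(* Fix integers $n,d\ge 1$, constants $0<h_{min}<h_{max}$, any initial state $\mathcal{X}^{(0)}\in\mathbb{R}^{dn}$, an initial bandwidth $h_1\in[h_{min},h_{max}]$, and a non-negative sequence $(\nu_k)$ with $\nu_k\to 0$. Let $(\mathcal{X}^{(k)})$, $\mathcal{X}^{(k)}=[\mathbf{x}_1^{(k)},\ldots,\mathbf{x}_n^{(k)}]$, be generated by the Doubly Stochastic Mean-Shift (DSMS) process described in the context, and let $\tau$ be a real number with $0<\tau<h_{min}/2$. Then almost surely there exist a partition $J_1,\ldots,J_M$ of $\{1,\ldots,n\}$ and an integer $K$ such that for every $k\ge K$: 1) for all $l\in[M]$, $\max_{i,j\in J_l}\|\mathbf{x}_i^{(k)}-\mathbf{x}_j^{(k)}\|<\tau$; 2) for all $l\ne m$ in $[M]$, $\min_{i\in J_l,\,j\in J_m}\|\mathbf{x}_i^{(k)}-\mathbf{x}_j^{(k)}\|>h_{min}-\tau$. That is, almost surely the points belong to fixed clusters $\mathcal{C}_l=\{\mathbf{x}_i^{(k)}: i\in J_l\}$ for all sufficiently large $k$. Moreover, almost surely the diameters of all clusters tend to $0$ as $k\to\infty$.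
   Context: A profile function is a map $k:[0,\infty)\to\mathbb{R}_+$ that vanishes on $[1,\infty)$, is $C^1$, non-increasing and convex, with $k'(t)<0$ for all $t\in[0,1)$. The associated kernel is $K(\mathbf{u})=k(\|\mathbf{u}\|^2)$ on $\mathbb{R}^d$ and the weight function is $G(\mathbf{u})=-k'(\|\mathbf{u}\|^2)$; $\|\cdot\|$ is the Euclidean norm. A state is $\mathcal{X}=[\mathbf{x}_1,\ldots,\mathbf{x}_n]\in\mathbb{R}^{dn}$, $\mathbf{x}_i\in\mathbb{R}^d$. Mean-shift operator for $h>0$: $\mathcal{S}_h(x;\mathcal{X})=\sum_{i=1}^n G((x-\mathbf{x}_i)/h)\mathbf{x}_i\big/\sum_{i=1}^n G((x-\mathbf{x}_i)/h)$. DSMS process: for $k=0,1,2,\ldots$: if $k\ge1$, set $\delta_k=\min\{\nu_k,\ (h_k/h_{min})^2-1,\ 1-(h_k/h_{max})^2\}$, draw $\alpha_k$ uniformly on $(1-\delta_k,1+\delta_k)$ (with $\alpha_k=1$ if $\delta_k=0$), and set $h_{k+1}=h_k/\sqrt{\alpha_k}$ (so $h_{k+1}\in[h_{min},h_{max}]$); draw $i_k$ uniformly from $\{1,\ldots,n\}$; set $\mathbf{x}_{i_k}^{(k+1)}=\mathcal{S}_{h_{k+1}}(\mathbf{x}_{i_k}^{(k)};\mathcal{X}^{(k)})$ and $\mathbf{x}_j^{(k+1)}=\mathbf{x}_j^{(k)}$ for $j\ne i_k$. The indices $i_k$ are i.i.d., independent of all previous choices, and $(i_k)$, $(h_k)$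 are independent. *)

(* Defs.v *)
From HB Require Import structures.
From mathcomp Require Import all_boot all_order all_algebra.
From mathcomp Require Import all_classical all_reals all_analysis.
Set Implicit Arguments. Unset Strict Implicit. Unset Printing Implicit Defensive.
Import Order.TTheory GRing.Theory Num.Theory.
Import numFieldNormedType.Exports.
Local Open Scope ring_scope.
Local Open Scope classical_set_scope.

Section DSMS.
Variable R : realType.

Definition eucnorm (d : nat) (u : 'rV[R]_d) : R :=
  Num.sqrt (\sum_(j < d) u ord0 j ^+ 2).

Definition eucdist (d : nat) (u v : 'rV[R]_d) : R := eucnorm (u - v).

(* Profile function k : [0,oo) -> R_+ (given as the restriction of a
   function R -> R that is C^1 on R). *)
Definition is_profile (k : R -> R) : Prop :=
  ((forall t, derivable k t 1) /\ continuous ((derive1 k))) /\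
  (forall t, 0 <= t -> 0 <= k t) /\
  (forall t, 1 <= t -> k t = 0) /\
  (forall s t, 0 <= s -> s <= t -> k t <= k s) /\
  (forall s t l, 0 <= s -> 0 <= t -> 0 <= l -> l <= 1 ->
      k (l * s + (1 - l) * t) <= l * k s + (1 - l) * k t) /\
  (forall t, 0 <= t -> t < 1 -> (derive1 k) t < 0).

Definition kernelK (k : R -> R) (d : nat) (u : 'rV[R]_d) : R := k (eucnorm u ^+ 2).
Definition weightG (k : R -> R) (d : nat) (u : 'rV[R]_d) : R := - ((derive1 k) (eucnorm u ^+ 2)).

Definition mean_shift (k : R -> R) (d n : nat) (h : R) (x : 'rV[R]_d)
    (X : 'I_n -> 'rV[R]_d) : 'rV[R]_d :=
  (\sum_(i < n) weightG k (h^-1 *: (x - X i)))^-1 *: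
    \sum_(i < n) (weightG k (h^-1 *: (x - X i)) *: X i).

Definition dsms_delta (hmin hmax nuk hk : R) : R :=
  Num.min nuk (Num.min ((hk / hmin) ^+ 2 - 1) (1 - (hk / hmax) ^+ 2)).

(* Bandwidths: dsms_band ... m = h_{m+1}.  alpha_k = 1 + delta_k * U_k with
   U_k uniform on (-1,1), i.e. alpha_k uniform on (1-delta_k, 1+delta_k). *)
Fixpoint dsms_band (hmin hmax h1 : R) (nu U : nat -> R) (m : nat) : R :=
  match m with
  | 0 => h1
  | m'.+1 =>
      let hk := dsms_band hmin hmax h1 nu U m' in
      let alpha := 1 + dsms_delta hmin hmax (nu m'.+1) hk * U m'.+1 in
      hk / Num.sqrt alpha
  end.

Fixpoint dsms_state (k : R -> R) (d n : nat) (hmin hmax h1 : R)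
    (nu U : nat -> R) (I : nat -> 'I_n) (X0 : 'I_n -> 'rV[R]_d) (m : nat)
    : 'I_n -> 'rV[R]_d :=
  match m with
  | 0 => X0
  | m'.+1 =>
      let X := dsms_state k hmin hmax h1 nu U I X0 m' in
      fun j => if j == I m'
               then mean_shift k (dsms_band hmin hmax h1 nu U m') (X (I m')) X
               else X j
  end.

End DSMS.

Definition open_m1_1 (R : realType) : set R := `]-1, 1[.

(* The driving randomness: i_k (k >= 0) i.i.d. uniform on 'I_n, U_k (k >= 0)
   i.i.d. uniform on (-1,1), all mutually independent (U_0 is unused).
   Stated through all finite-dimensional joint laws. *)
Definition dsms_noise (R : realType) (dT : measure_display) (T : measurableType dT)
    (P : probability T R) (n : nat) (I : nat -> T -> 'I_n) (U : nat -> T -> R) : Prop :=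
  (forall m (a : 'I_n), measurable [set w | I m w = a]) /\
  (forall m, measurable_fun setT (U m)) /\
  (forall (N : nat) (a : nat -> 'I_n) (B : nat -> set R),
      (forall m, measurable (B m)) ->
      P (\bigcap_(m in [set m | (m < N)%N]) [set w | I m w = a m /\ B m (U m w)])
      = (\prod_(m < N) ((n%:R)^-1%:E *
           ((@lebesgue_measure R (B m `&` @open_m1_1 R)) * (2^-1)%:E)))%E).

(* Main.v *)
Require Import Defs.
From HB Require Import structures.
From mathcomp Require Import all_boot all_order all_algebra.
From mathcomp Require Import all_classical all_reals all_analysis.
From mathcomp Require Import measurable_realfun ring lra.
Set Implicit Arguments. Unset Strict Implicit. Unset Printing Implicit Defensive.
Import Order.TTheory GRing.Theory Num.Theory.
Import numFieldNormedType.Exports.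
Local Open Scope ring_scope.
Local Open Scope classical_set_scope.

(** The energy [sum_ij K((x_i - x_j) / h)] is bounded, and it is a submartingale
    along the process. Convexity of the profile bounds the kernel below by its
    tangents, so a mean-shift step of [x_i] raises the energy by at least a constant
    times [|S_h(x_i) - x_i|^2], while a bandwidth step multiplies [1/h^2] by a factor
    of mean 1 and hence does not decrease it on average. As the moving index is
    uniform and independent of the past, the expectations of all the
    [|S_h(x_i) - x_i|^2] are summable over time, so almost surely every mean-shift
    vector tends to 0. Pairing the mean-shift vector of [x_i] with [x_i] and summing
    over [i] then gives [G_ij |x_i - x_j|^2 -> 0] for every pair: in the limit two
    points are either together or at distance at least [hmin]. Since steps tend to 0,
    no pair can cross from one alternative to the other infinitely often. *)

(** * Euclidean geometry of row vectors *)

Section Euclidean.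
Variables (R : realType) (d : nat).
Implicit Types u v w : 'rV[R]_d.

Definition dotprod u v : R := \sum_(l < d) u ord0 l * v ord0 l.

Lemma dotprodC u v : dotprod u v = dotprod v u.
Proof. by apply: eq_bigr => l _; rewrite mulrC. Qed.

Lemma dotprodDl u v w : dotprod (u + v) w = dotprod u w + dotprod v w.
Proof. by rewrite /dotprod -big_split; apply: eq_bigr => l _; rewrite mxE mulrDl. Qed.

Lemma dotprodZl a u v : dotprod (a *: u) v = a * dotprod u v.
Proof. by rewrite /dotprod mulr_sumr; apply: eq_bigr => l _; rewrite mxE mulrA. Qed.

Lemma dotprodNl u v : dotprod (- u) v = - dotprod u v.
Proof. by rewrite -scaleN1r dotprodZl mulN1r. Qed.

Lemma dotprodDr u v w : dotprod u (v + w) = dotprod u v + dotprod u w.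
Proof. by rewrite !(dotprodC u) dotprodDl. Qed.

Lemma dotprodZr a u v : dotprod u (a *: v) = a * dotprod u v.
Proof. by rewrite !(dotprodC u) dotprodZl. Qed.

Lemma dotprodNr u v : dotprod u (- v) = - dotprod u v.
Proof. by rewrite !(dotprodC u) dotprodNl. Qed.

Lemma dotprod0r u : dotprod u 0 = 0.
Proof. by rewrite -(scale0r 0) dotprodZr mul0r. Qed.

Lemma dotprod_sumr (J : finType) (F : J -> 'rV[R]_d) u :
  dotprod u (\sum_j F j) = \sum_j dotprod u (F j).
Proof. by apply: big_morph => [v w|]; rewrite ?dotprodDr ?dotprod0r. Qed.

Lemma eucnorm_ge0 u : 0 <= eucnorm u.
Proof. exact: sqrtr_ge0. Qed.

Lemma eucnorm_sqr u : eucnorm u ^+ 2 = dotprod u u.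
Proof.
rewrite sqr_sqrtr; last by apply: sumr_ge0 => l _; exact: sqr_ge0.
by apply: eq_bigr => l _; rewrite expr2.
Qed.

Lemma eucnorm_sqrD u v :
  eucnorm (u + v) ^+ 2 = eucnorm u ^+ 2 + 2 * dotprod u v + eucnorm v ^+ 2.
Proof. by rewrite !eucnorm_sqr dotprodDl !dotprodDr (dotprodC v u); ring. Qed.

Lemma eucnormZ a u : eucnorm (a *: u) = `|a| * eucnorm u.
Proof.
apply/eqP; rewrite -(@eqrXn2 _ 2) ?mulr_ge0 ?eucnorm_ge0// exprMn.
by rewrite real_normK ?num_real// !eucnorm_sqr dotprodZl dotprodZr mulrA expr2.
Qed.

Lemma eucnorm0 : eucnorm (0 : 'rV[R]_d) = 0.
Proof. by rewrite -(scale0r 0) eucnormZ normr0 mul0r. Qed.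

Lemma eucnormN u : eucnorm (- u) = eucnorm u.
Proof. by rewrite -scaleN1r eucnormZ normrN1 mul1r. Qed.

Lemma eucnorm_eq0 u : eucnorm u = 0 -> u = 0.
Proof.
move=> /(congr1 (fun x => x ^+ 2)); rewrite eucnorm_sqr expr0n /= => /eqP.
rewrite psumr_eq0 => [/allP uu0|l _]; last by rewrite -expr2 sqr_ge0.
apply/rowP => l; rewrite mxE; apply/eqP.
by have := uu0 l (mem_index_enum l); rewrite mulf_eq0 orbb.
Qed.

Lemma cauchy_schwarz u v : `|dotprod u v| <= eucnorm u * eucnorm v.
Proof.
set a := eucnorm u; set b := eucnorm v.
have [a0|a_neq0] := eqVneq a 0.
  by rewrite (eucnorm_eq0 a0) dotprodC dotprod0r normr0 mulr_ge0 ?eucnorm_ge0.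
have [b0|b_neq0] := eqVneq b 0.
  by rewrite (eucnorm_eq0 b0) dotprod0r normr0 mulr_ge0 ?eucnorm_ge0.
have ab_gt0 : 0 < a * b by rewrite mulr_gt0 ?lt0r ?a_neq0 ?b_neq0 ?eucnorm_ge0.
have expand (s : R) : s ^+ 2 = 1 -> 0 <= (a * b) * (a * b + s * dotprod u v).
  move=> s1; have := sqr_ge0 (eucnorm (b *: u + (s * a) *: v)).
  rewrite eucnorm_sqrD !eucnormZ dotprodZl dotprodZr -/a -/b.
  rewrite !exprMn !real_normK ?num_real// exprMn s1; lra.
rewrite ler_norml -2!subr_ge0.
have := expand 1 (expr1n _ _); have := expand (-1) (sqrr_sign _ 1).
by rewrite !pmulr_rge0// => ? ?; apply/andP; lra.
Qed.

Lemma dotprod_ge u v : - (eucnorm u * eucnorm v) <= dotprod u v.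
Proof. by have := cauchy_schwarz u v; rewrite ler_norml => /andP[]. Qed.

Lemma ler_eucnormD u v : eucnorm (u + v) <= eucnorm u + eucnorm v.
Proof.
rewrite -(@ler_pXn2r _ 2) ?nnegrE ?addr_ge0 ?eucnorm_ge0// eucnorm_sqrD sqrrD.
have := le_trans (ler_norm _) (cauchy_schwarz u v); lra.
Qed.

Lemma ler_eucnorm_sum (J : finType) (F : J -> 'rV[R]_d) :
  eucnorm (\sum_j F j) <= \sum_j eucnorm (F j).
Proof.
elim/big_ind2: _ => [|u x v y ux vy|//]; first by rewrite eucnorm0.
exact: le_trans (ler_eucnormD _ _) (lerD ux vy).
Qed.

Lemma eucdistxx u : eucdist u u = 0.
Proof. by rewrite /eucdist subrr eucnorm0. Qed.

Lemma eucdistC u v : eucdist u v = eucdist v u.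
Proof. by rewrite /eucdist -eucnormN opprB. Qed.

Lemma eucdist_triangle u v w : eucdist u w <= eucdist u v + eucdist v w.
Proof. by rewrite /eucdist -(subrKA v); exact: ler_eucnormD. Qed.

Lemma ler_dist_eucdist u u' v v' :
  `|eucdist u' v' - eucdist u v| <= eucdist u' u + eucdist v' v.
Proof.
have := eucdist_triangle u' u v'; have := eucdist_triangle u v v'.
have := eucdist_triangle u u' v; have := eucdist_triangle u' v' v.
by rewrite (eucdistC u u') (eucdistC v v') ler_norml => *; apply/andP; lra.
Qed.

End Euclidean.

(** * Kernels of convex profiles *)

Lemma convex_tangent (R : realType) (f : R -> R) (a b : R) :
  derivable f a 1 ->
  (forall l, 0 <= l <= 1 -> f (l * b + (1 - l) * a) <= l * f b + (1 - l) * f a) ->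
  f a + derive1 f a * (b - a) <= f b.
Proof.
move=> df convf.
have diff_f : differentiable f a by exact/derivable1_diffP.
have derivE : 'D_(b - a) f a = (b - a) * derive1 f a.
  by rewrite deriveE// derive1E deriveE// -[in LHS](mulr1 (b - a)) linearZ.
have dfba : derivable f a (b - a) by exact/diff_derivable.
suff : 'D_(b - a) f a <= f b - f a by rewrite derivE; lra.
rewrite /derive cvg_at_rightE//; apply: limr_le.
  apply: cvgP; apply: cvg_trans; last exact: dfba.
  apply: cvg_app => A; rewrite /dnbhs /at_right !nbhs_simpl/= => dA.
  apply: (@filterS _ (nbhs (0 : R)) _ _ _ _ dA) => x h x0.
  exact/h/lt0r_neq0.
near=> l => /=.
have l0 : 0 < l by near: l; exact: nbhs_right_gt.
have l1 : l <= 1 by near: l; exact: nbhs_right_le.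
have -> : l *: (b - a) + a = l * b + (1 - l) * a by rewrite /GRing.scale/=; ring.
have := convf l; rewrite l1 ltW// => /(_ isT).
by rewrite /GRing.scale/= ler_pdivrMl//; lra.
Unshelve. all: by end_near. Qed.

Section Profile.
Variables (R : realType) (k : R -> R).
Hypothesis profile_k : is_profile k.

Lemma profile_ge0 t : 0 <= t -> 0 <= k t.
Proof. by case: profile_k => _ [k_ge0 _]; exact: k_ge0. Qed.

Lemma profile_nincr s t : 0 <= s -> s <= t -> k t <= k s.
Proof. by case: profile_k => _ [_ [_ [k_nincr _]]]; exact: k_nincr. Qed.

Lemma profile_tangent a b : 0 <= a -> 0 <= b -> k a + derive1 k a * (b - a) <= k b.
Proof.
case: profile_k => -[derivable_k _] [_ [_ [_ [convex_k _]]]] a0 b0.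
by apply: convex_tangent => // l /andP[l0 l1]; exact: convex_k.
Qed.

Lemma derive1_profile_le0 t : 0 <= t -> derive1 k t <= 0.
Proof.
move=> t0; have t10 : 0 <= t + 1 by lra.
have := profile_tangent t0 t10; have := @profile_nincr t (t + 1) t0 ltac:(lra).
lra.
Qed.

Lemma derive1_profile_ndecr s t : 0 <= s -> s <= t -> derive1 k s <= derive1 k t.
Proof.
move=> s0; rewrite le_eqVlt => /orP[/eqP->//|st].
have t0 : 0 <= t by lra.
have := profile_tangent s0 t0; have := profile_tangent t0 s0 => tang_ts tang_st.
have : 0 <= (derive1 k t - derive1 k s) * (t - s) by lra.
by rewrite pmulr_lge0 ?subr_gt0// subr_ge0.
Qed.

Lemma derive1_profile_lt0 t : 0 <= t -> t < 1 -> derive1 k t < 0.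
Proof. by case: profile_k => _ [_ [_ [_ [_ k'_lt0]]]]; exact: k'_lt0. Qed.

Section Kernel.
Variable d : nat.
Implicit Types u v : 'rV[R]_d.

Lemma kernelK_ge0 u : 0 <= kernelK k u.
Proof. exact/profile_ge0/sqr_ge0. Qed.

Lemma kernelK_le u : kernelK k u <= k 0.
Proof. by apply: profile_nincr => //; exact: sqr_ge0. Qed.

Lemma kernelK_tangent u v :
  kernelK k u + weightG k u * (eucnorm u ^+ 2 - eucnorm v ^+ 2) <= kernelK k v.
Proof.
have := profile_tangent (sqr_ge0 (eucnorm u)) (sqr_ge0 (eucnorm v)).
by rewrite /kernelK /weightG; lra.
Qed.

Lemma weightGN u : weightG k (- u) = weightG k u.
Proof. by rewrite /weightG eucnormN. Qed.

Lemma weightG0 : weightG k (0 : 'rV[R]_d) = - derive1 k 0.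
Proof. by rewrite /weightG eucnorm0 expr0n. Qed.

Lemma weightG_ge0 u : 0 <= weightG k u.
Proof. by rewrite oppr_ge0 derive1_profile_le0 ?sqr_ge0. Qed.

Lemma weightG_le0 u : weightG k u <= - derive1 k 0.
Proof. by rewrite lerN2 derive1_profile_ndecr ?sqr_ge0. Qed.

Lemma weightG_ge u r : eucnorm u <= r -> - derive1 k (r ^+ 2) <= weightG k u.
Proof.
move=> ur; rewrite lerN2 derive1_profile_ndecr ?sqr_ge0//.
by rewrite ler_pXn2r ?nnegrE ?eucnorm_ge0 ?(le_trans (eucnorm_ge0 u)).
Qed.

Lemma weightG_sqr_eucnorm_le u : weightG k u * eucnorm u ^+ 2 <= k 0.
Proof.
have := profile_tangent (sqr_ge0 (eucnorm u)) (lexx 0).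
have := kernelK_ge0 u; rewrite /weightG /kernelK; lra.
Qed.

End Kernel.
End Profile.

(** * Mean shift and energy *)

Lemma sum_symmetric_star (R : pzRingType) (V : finType) (F : V -> V -> R) (i : V) :
  (forall a b, F a b = F b a) ->
  (forall a b, a != i -> b != i -> F a b = 0) ->
  \sum_a \sum_b F a b = (\sum_b F i b) *+ 2 - F i i.
Proof.
move=> F_sym F_off; rewrite (bigD1 i)//= mulr2n -addrA; congr (_ + _).
rewrite [in RHS](bigD1 i)//= addrC addKr; apply: eq_bigr => a ai.
by rewrite (bigD1 i)//= big1 ?addr0// => b; exact: F_off.
Qed.

Lemma ler_sum2_const (R : numDomainType) (n : nat) (F : 'I_n -> 'I_n -> R) (c : R) :
  (forall i j, F i j <= c) -> \sum_i \sum_j F i j <= n%:R ^+ 2 * c.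
Proof.
move=> Fc; apply: (@le_trans _ _ (\sum_(i < n) \sum_(j < n) c)).
  by apply: ler_sum => i _; exact: ler_sum.
by rewrite !sumr_const !card_ord -mulrnA -[leLHS]mulr_natl natrM expr2.
Qed.

Section MeanShift.
Variables (R : realType) (k : R -> R) (n d : nat).
Hypothesis profile_k : is_profile k.
Implicit Types (X Y : 'I_n -> 'rV[R]_d) (h : R) (i j : 'I_n).

Definition scaled_diff h X i j : 'rV[R]_d := h^-1 *: (X i - X j).

Definition energy h X : R := \sum_i \sum_j kernelK k (scaled_diff h X i j).

Definition pair_weight h X i j : R := weightG k (scaled_diff h X i j).

Definition total_weight h X i : R := \sum_j pair_weight h X i j.

Definition mean_shift_vector h X i : 'rV[R]_d := mean_shift k h (X i) X - X i.

Definition move_point h X i : 'I_n -> 'rV[R]_d :=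
  fun j => if j == i then mean_shift k h (X i) X else X j.

Lemma scaled_diffC h X i j : scaled_diff h X i j = - scaled_diff h X j i.
Proof. by rewrite /scaled_diff -scalerN opprB. Qed.

Lemma scaled_diffxx h X i : scaled_diff h X i i = 0.
Proof. by rewrite /scaled_diff subrr scaler0. Qed.

Lemma eucnorm_scaled_diff h X i j : 0 < h ->
  eucnorm (scaled_diff h X i j) = eucdist (X i) (X j) / h.
Proof. by move=> h0; rewrite eucnormZ gtr0_norm ?invr_gt0// mulrC. Qed.

Lemma sqr_eucnorm_scaled_diff h X i j :
  eucnorm (scaled_diff h X i j) ^+ 2 = h^-1 ^+ 2 * eucdist (X i) (X j) ^+ 2.
Proof. by rewrite eucnormZ exprMn real_normK ?num_real. Qed.

Lemma pair_weightC h X i j : pair_weight h X i j = pair_weight h X j i.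
Proof. by rewrite /pair_weight scaled_diffC weightGN. Qed.

Lemma pair_weight_ge0 h X i j : 0 <= pair_weight h X i j.
Proof. exact: weightG_ge0. Qed.

Lemma pair_weightxx h X i : pair_weight h X i i = - derive1 k 0.
Proof. by rewrite /pair_weight scaled_diffxx weightG0. Qed.

Lemma pair_weight_ge (hmin hmax e : R) h X i j : 0 < hmin -> hmin <= h <= hmax ->
  0 < e -> eucdist (X i) (X j) <= hmin - e ->
  - derive1 k ((1 - e / hmax) ^+ 2) <= pair_weight h X i j.
Proof.
move=> hmin_gt0 /andP[hmin_le hmax_ge] e0 near_ij.
have h_gt0 : 0 < h by exact: lt_le_trans hmin_le.
apply: weightG_ge => //; rewrite eucnorm_scaled_diff// ler_pdivrMr//.
have : e / hmax * h <= e.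
  by rewrite mulrAC ler_pdivrMr ?(lt_le_trans h_gt0)// ler_pM2l.
lra.
Qed.

Lemma total_weight_ge h X i : - derive1 k 0 <= total_weight h X i.
Proof.
rewrite /total_weight (bigD1 i)//= pair_weightxx lerDl.
by apply: sumr_ge0 => j _; exact: pair_weight_ge0.
Qed.

Lemma total_weight_gt0 h X i : 0 < total_weight h X i.
Proof.
by apply: lt_le_trans (total_weight_ge h X i); rewrite oppr_gt0 derive1_profile_lt0.
Qed.

Lemma total_weight_le h X i : total_weight h X i <= n%:R * - derive1 k 0.
Proof.
apply: (@le_trans _ _ (\sum_(j < n) - derive1 k 0)).
  by apply: ler_sum => j _; exact: weightG_le0.
by rewrite sumr_const card_ord mulr_natl.
Qed.

Lemma total_weight_mean_shift h X i :
  total_weight h X i *: mean_shift k h (X i) X = \sum_j pair_weight h X i j *: X j.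
Proof. by rewrite scalerA divff ?scale1r// gt_eqF ?total_weight_gt0. Qed.

Lemma total_weight_mean_shift_vector h X i :
  total_weight h X i *: mean_shift_vector h X i =
  \sum_j pair_weight h X i j *: (X j - X i).
Proof.
rewrite scalerBr total_weight_mean_shift scaler_suml -sumrB.
by apply: eq_bigr => j _; rewrite scalerBr.
Qed.

Lemma eucnorm_mean_shift_le h X i (C : R) :
  (forall j, eucnorm (X j) <= C) -> eucnorm (mean_shift k h (X i) X) <= C.
Proof.
move=> XC; have W0 := total_weight_gt0 h X i.
rewrite -(ler_pM2l W0) -{1}(gtr0_norm W0) -eucnormZ total_weight_mean_shift.
apply: le_trans (ler_eucnorm_sum _) _; rewrite mulr_suml; apply: ler_sum => j _.
by rewrite eucnormZ ger0_norm ?pair_weight_ge0// ler_wpM2l ?pair_weight_ge0.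
Qed.

Lemma eucnorm_move_point_le h X i (C : R) : (forall j, eucnorm (X j) <= C) ->
  forall j, eucnorm (move_point h X i j) <= C.
Proof.
move=> XC j; rewrite /move_point; case: eqP => // _.
exact: eucnorm_mean_shift_le.
Qed.

Lemma eucdist_move_point_le h X i j :
  eucdist (move_point h X i j) (X j) <= eucnorm (mean_shift_vector h X j).
Proof.
by rewrite /move_point; case: eqP => [->//|_]; rewrite eucdistxx eucnorm_ge0.
Qed.

Lemma mean_shift_variance_decrease h X i :
  \sum_j pair_weight h X i j *
    (eucdist (X i) (X j) ^+ 2 - eucdist (mean_shift k h (X i) X) (X j) ^+ 2)
  = total_weight h X i * eucnorm (mean_shift_vector h X i) ^+ 2.
Proof.
set s := mean_shift_vector h X i.
have expand j :
    eucdist (X i) (X j) ^+ 2 - eucdist (mean_shift k h (X i) X) (X j) ^+ 2 =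
    2 * dotprod s (X j - X i) - eucnorm s ^+ 2.
  rewrite [X in _ - X](_ : _ = eucnorm (s + (X i - X j)) ^+ 2); last first.
    by rewrite addrA subrK.
  by rewrite eucnorm_sqrD -(opprB (X i)) dotprodNr /eucdist; ring.
have dotE : \sum_j pair_weight h X i j * dotprod s (X j - X i) =
    total_weight h X i * eucnorm s ^+ 2.
  rewrite eucnorm_sqr -dotprodZr total_weight_mean_shift_vector dotprod_sumr.
  by apply: eq_bigr => j _; rewrite dotprodZr.
under eq_bigr do rewrite expand mulrBr mulrCA.
rewrite sumrB -mulr_sumr dotE -mulr_suml -/(total_weight h X i); ring.
Qed.

Lemma energy_tangent h h' X Y :
  energy h X + \sum_i \sum_j pair_weight h X i j *
    (eucnorm (scaled_diff h X i j) ^+ 2 - eucnorm (scaled_diff h' Y i j) ^+ 2)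
  <= energy h' Y.
Proof.
rewrite -big_split; apply: ler_sum => i _; rewrite -big_split; apply: ler_sum => j _.
exact: kernelK_tangent.
Qed.

Lemma energy_move_point h X i :
  energy h X + 2 * (h^-1 ^+ 2 *
    (total_weight h X i * eucnorm (mean_shift_vector h X i) ^+ 2))
  <= energy h (move_point h X i).
Proof.
apply: le_trans (energy_tangent h h X (move_point h X i)); rewrite lerD2l.
rewrite (sum_symmetric_star (i := i)) => [|a b|a b ai bi]; last 2 first.
- rewrite pair_weightC (scaled_diffC _ X) eucnormN.
  by rewrite (scaled_diffC _ (move_point h X i)) eucnormN.
- by rewrite /scaled_diff /move_point (negbTE ai) (negbTE bi) subrr mulr0.
rewrite !scaled_diffxx eucnorm0 subrr [X in _ - X]mulr0 subr0.
rewrite -[leRHS]mulr_natl ler_pM2l//.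
rewrite -mean_shift_variance_decrease mulr_sumr; apply: ler_sum => j _.
rewrite !sqr_eucnorm_scaled_diff -mulrBr mulrCA.
rewrite ler_wpM2l ?pair_weight_ge0// ler_wpM2l ?sqr_ge0// lerB// /move_point eqxx.
by case: eqP => // ->; rewrite eucdistxx expr0n sqr_ge0.
Qed.

Definition scaling_drift h X : R :=
  \sum_i \sum_j pair_weight h X i j * eucnorm (scaled_diff h X i j) ^+ 2.

Lemma energy_rescale h h' X (e : R) : h'^-1 ^+ 2 = (1 + e) * h^-1 ^+ 2 ->
  energy h X - scaling_drift h X * e <= energy h' X.
Proof.
move=> hE; apply: le_trans (energy_tangent h h' X X); rewrite lerD2l -mulNr.
rewrite -sumrN mulr_suml; apply: ler_sum => i _; rewrite -sumrN mulr_suml.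
apply: ler_sum => j _; rewrite !sqr_eucnorm_scaled_diff hE.
by rewrite le_eqVlt; apply/orP; left; apply/eqP; ring.
Qed.

Lemma energy_ge0 h X : 0 <= energy h X.
Proof. by do 2 (apply: sumr_ge0 => ? _); exact: kernelK_ge0. Qed.

Lemma energy_le h X : energy h X <= n%:R ^+ 2 * k 0.
Proof. by apply: ler_sum2_const => i j; exact: kernelK_le. Qed.

Lemma scaling_drift_ge0 h X : 0 <= scaling_drift h X.
Proof.
by do 2 (apply: sumr_ge0 => ? _); rewrite mulr_ge0 ?pair_weight_ge0 ?sqr_ge0.
Qed.

Lemma scaling_drift_le h X : scaling_drift h X <= n%:R ^+ 2 * k 0.
Proof. by apply: ler_sum2_const => i j; exact: weightG_sqr_eucnorm_le. Qed.

Lemma sum_pair_weight_sqr_eucdist h X :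
  \sum_i \sum_j pair_weight h X i j * eucdist (X i) (X j) ^+ 2 =
  - 2 * \sum_i total_weight h X i * dotprod (mean_shift_vector h X i) (X i).
Proof.
pose w_dot i j := pair_weight h X i j * dotprod (X j - X i) (X i).
have -> : \sum_i total_weight h X i * dotprod (mean_shift_vector h X i) (X i) =
    \sum_i \sum_j w_dot i j.
  apply: eq_bigr => i _; rewrite -dotprodZl total_weight_mean_shift_vector dotprodC.
  by rewrite dotprod_sumr; apply: eq_bigr => j _; rewrite dotprodC dotprodZl.
have w_dotC : \sum_i \sum_j w_dot i j = \sum_i \sum_j w_dot j i.
  by rewrite exchange_big.
rewrite mulNr mulr_natl mulr2n {2}w_dotC -big_split -sumrN; apply: eq_bigr => i _.
rewrite -big_split -sumrN; apply: eq_bigr => j _ /=.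
rewrite /w_dot (pair_weightC h X j i) /eucdist eucnorm_sqr.
by rewrite -(opprB (X i) (X j)) dotprodNl dotprodDr dotprodNr; ring.
Qed.

Lemma pair_weight_sqr_eucdist_le h X i j (C : R) : (forall a, eucnorm (X a) <= C) ->
  pair_weight h X i j * eucdist (X i) (X j) ^+ 2 <=
  2 * (n%:R * - derive1 k 0) * C * \sum_a eucnorm (mean_shift_vector h X a).
Proof.
move=> XC; pose p a b := pair_weight h X a b * eucdist (X a) (X b) ^+ 2.
have p_ge0 a b : 0 <= p a b by rewrite mulr_ge0 ?pair_weight_ge0 ?sqr_ge0.
apply: (@le_trans _ _ (\sum_a \sum_b p a b)).
  rewrite (bigD1 i)//= (bigD1 j)//= -addrA lerDl addr_ge0//.
    by apply: sumr_ge0 => b _.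
  by apply: sumr_ge0 => a _; apply: sumr_ge0.
rewrite sum_pair_weight_sqr_eucdist mulNr -mulrN -!mulrA ler_pM2l//.
rewrite -sumrN !mulr_sumr.
apply: ler_sum => a _.
set s := mean_shift_vector h X a.
have dot_le : - dotprod s (X a) <= eucnorm s * C.
  rewrite lerNl; apply: le_trans (dotprod_ge _ _).
  by rewrite lerN2 ler_wpM2l ?eucnorm_ge0.
rewrite -mulrN; apply: le_trans (ler_wpM2l (ltW (total_weight_gt0 h X a)) dot_le) _.
rewrite [leRHS](_ : _ = n%:R * - derive1 k 0 * (eucnorm s * C)); last by ring.
by rewrite ler_wpM2r ?total_weight_le ?mulr_ge0 ?(le_trans _ (XC a)) ?eucnorm_ge0.
Qed.

End MeanShift.

(** * Formation of the clusters *)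

Lemma equivalence_labelling (V : finType) (r : rel V) : equivalence_rel r ->
  exists (M : nat) (c : V -> 'I_M),
    (forall l, exists i, c i = l) /\ (forall i j, (c i == c j) = r i j).
Proof.
move=> r_equiv; pose Q := equivalence_partition r [set: V]%SET.
have r_equivT : {in [set: V]%SET & &, equivalence_rel r} by move=> ? ? ? _ _ _.
have /and3P[/eqP coverQ trivQ _] := equivalence_partitionP r_equivT.
pose block i := finset.pblock Q i.
have blockQ i : block i \in Q by rewrite finset.pblock_mem// coverQ inE.
exists #|Q|, (fun i => enum_rank_in (blockQ i) (block i)); split=> [l|i j].
  have /imsetP[i _ l_block] := enum_valP l; exists i; apply: enum_val_inj.
  rewrite enum_rankK_in//; apply: finset.def_pblock => //; first exact: enum_valP.
  by rewrite l_block !inE; case: (r_equiv i i i).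
rewrite -(inj_eq enum_val_inj) !enum_rankK_in// finset.eq_pblock ?coverQ ?inE//.
by rewrite pblock_equivalence_partition ?inE.
Qed.

Lemma no_gap_crossing (R : realDomainType) (u : nat -> R) (a b : R) :
  (forall m, u m < a \/ b < u m) -> (forall m, `|u m.+1 - u m| < b - a) ->
  forall m, (u m < a) = (u 0%N < a).
Proof.
move=> gap step; elim=> // m <-.
have := gap m; have := gap m.+1; have := step m; rewrite ltr_norml => /andP[? ?].
by move=> gapS gapm; apply/idP/idP => ?; [case: gapm|case: gapS] => // ?; lra.
Qed.

Definition asymptotic_gap (R : realType) (h : R) (u : R^nat) : Prop :=
  forall e, 0 < e -> e < h -> \forall m \near \oo, u m < e \/ h - e < u m.

Lemma asymptotic_gap_cvg0 (R : realType) (h tau : R) (u : R^nat) :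
  0 < tau -> tau < h / 2 -> asymptotic_gap h u ->
  (\forall m \near \oo, 0 <= u m < tau) -> u @ \oo --> 0.
Proof.
move=> tau_gt0 tau_lt u_gap u_small; apply/cvgr0Pnorm_lt => e e0.
pose e' := Num.min e tau.
have e'0 : 0 < e' by rewrite lt_min e0.
have e'_tau : e' <= tau by rewrite ge_min lexx orbT.
near=> m.
have /andP[um0 um_tau] : 0 <= u m < tau by near: m.
have : u m < e' \/ h - e' < u m by near: m; apply: u_gap => //; lra.
by rewrite lt_min ger0_norm// => -[/andP[]//|um_big]; lra.
Unshelve. all: by end_near. Qed.

Lemma asymptotic_gap_dichotomy (R : realType) (h tau : R) (u : R^nat) :
  0 < tau -> tau < h / 2 -> asymptotic_gap h u ->
  (fun m => u m.+1 - u m) @ \oo --> 0 ->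
  (\forall m \near \oo, u m < tau) \/ (\forall m \near \oo, h - tau < u m).
Proof.
move=> tau_gt0 tau_lt u_gap /cvgr0Pnorm_lt u_step.
have [tau_lt_h width_gt0] : tau < h /\ 0 < h - tau - tau by lra.
have [K _ gapK] := filterI (u_gap _ tau_gt0 tau_lt_h) (u_step _ width_gt0).
have stays m : (K <= m)%N -> (u m < tau) = (u K < tau).
  move=> /subnK <-.
  apply: (@no_gap_crossing _ (fun p => u (p + K)%N) _ (h - tau)) => p;
    by have [] := gapK (p + K)%N (leq_addl p K).
have [small|big] := boolP (u K < tau); [left|right]; exists K => // m /= Km.
  by rewrite stays.
by have [[um_small|//] _] := gapK m Km; rewrite -(stays m Km) um_small in big.
Qed.

Section PseudometricClusters.
Variables (R : realType) (V : finType) (h tau : R) (dist : nat -> V -> V -> R).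

Definition eventual_clusters (M : nat) (c : V -> 'I_M) : Prop :=
  (forall l, exists i, c i = l) /\
  (exists K : nat, forall m, (K <= m)%N ->
     (forall i j, c i = c j -> dist m i j < tau) /\
     (forall i j, c i <> c j -> h - tau < dist m i j)) /\
  (forall i j, c i = c j -> (fun m => dist m i j) @ \oo --> 0).

Hypotheses (tau_gt0 : 0 < tau) (tau_lt : tau < h / 2).
Hypothesis dist_ge0 : forall m i j, 0 <= dist m i j.
Hypothesis dist_refl : forall m i, dist m i i = 0.
Hypothesis dist_sym : forall m i j, dist m i j = dist m j i.
Hypothesis dist_triangle : forall m i j l, dist m i l <= dist m i j + dist m j l.
Hypothesis dist_gap : forall i j, asymptotic_gap h (fun m => dist m i j).
Hypothesis dist_step : forall i j,
  (fun m => dist m.+1 i j - dist m i j) @ \oo --> 0.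

Definition merging : rel V := fun i j => `[< (fun m => dist m i j) @ \oo --> 0 >].

Lemma merging_equivalence : equivalence_rel merging.
Proof.
have merging_trans : transitive merging.
  move=> j i l /asboolP ij /asboolP jl; apply/asboolP.
  apply: (@squeeze_cvgr _ _ _ _ (fun=> 0) (fun m => dist m i j + dist m j l)).
  - by near=> m; rewrite dist_ge0 dist_triangle.
  - exact: cvg_cst.
  - by rewrite -[X in _ --> X]addr0; exact: cvgD.
have merging_sym : symmetric merging.
  by move=> i j; rewrite /merging; under eq_fun do rewrite dist_sym.
apply/equivalence_relP; split=> [i|]; last exact: sym_left_transitive.
by apply/asboolP; under eq_fun do rewrite dist_refl; exact: cvg_cst.
Unshelve. all: by end_near. Qed.

Lemma merging_separation i j : \forall m \near \oo,
  if merging i j then dist m i j < tau else h - tau < dist m i j.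
Proof.
have [/asboolP ij|/asboolP ij] := boolP (merging i j).
  exact: cvgr_lt ij _ tau_gt0.
have [small|//] :=
  asymptotic_gap_dichotomy tau_gt0 tau_lt (@dist_gap i j) (@dist_step i j).
case: ij; apply: (asymptotic_gap_cvg0 tau_gt0 tau_lt (@dist_gap i j)).
by apply: filterS small => m ->; rewrite dist_ge0.
Qed.

Lemma gap_clusters : exists (M : nat) (c : V -> 'I_M), eventual_clusters c.
Proof.
have [M [c [c_surj cE]]] := equivalence_labelling merging_equivalence.
have [K _ sepK] : \forall m \near \oo, forall i j,
    if merging i j then dist m i j < tau else h - tau < dist m i j.
  by do 2 (apply: filter_forall => ?); exact: merging_separation.
exists M, c; split=> //; split.
  exists K => m Km; split=> i j; have := sepK m Km i j; rewrite -cE.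
    by move=> + cij; rewrite cij eqxx.
  by move=> + /eqP/negbTE cij; rewrite cij.
by move=> i j /eqP; rewrite cE => /asboolP.
Qed.

End PseudometricClusters.

Section VanishingShifts.
Variables (R : realType) (k : R -> R) (n d : nat) (hmin hmax tau C : R).
Variables (X : nat -> 'I_n -> 'rV[R]_d) (h : nat -> R) (I : nat -> 'I_n).
Hypothesis profile_k : is_profile k.
Hypotheses (hmin_gt0 : 0 < hmin) (tau_gt0 : 0 < tau) (tau_lt : tau < hmin / 2).
Hypothesis h_bounds : forall m, hmin <= h m <= hmax.
Hypothesis X_step : forall m, X m.+1 = move_point k (h m) (X m) (I m).
Hypothesis X_bounded : forall m i, eucnorm (X m i) <= C.
Hypothesis shift_cvg0 :
  forall i, (fun m => eucnorm (mean_shift_vector k (h m) (X m) i)) @ \oo --> 0.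

Lemma eucdist_step_cvg0 i j :
  (fun m => eucdist (X m.+1 i) (X m.+1 j) - eucdist (X m i) (X m j)) @ \oo --> 0.
Proof.
have shifts_cvg0 : (fun m => eucnorm (mean_shift_vector k (h m) (X m) i) +
    eucnorm (mean_shift_vector k (h m) (X m) j)) @ \oo --> 0.
  by rewrite -[X in _ --> X]addr0; exact: cvgD.
apply/cvgr0Pnorm_lt => e e0; near=> m.
apply: (@le_lt_trans _ _ (eucnorm (mean_shift_vector k (h m) (X m) i) +
    eucnorm (mean_shift_vector k (h m) (X m) j))).
  rewrite X_step; apply: le_trans (ler_dist_eucdist _ _ _ _) _.
  by apply: lerD; exact: eucdist_move_point_le.
by near: m; exact: (cvgr_lt _ shifts_cvg0).
Unshelve. all: by end_near. Qed.

Lemma eucdist_gap i j : asymptotic_gap hmin (fun m => eucdist (X m i) (X m j)).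
Proof.
move=> e e0 e_lt; pose w := - derive1 k ((1 - e / hmax) ^+ 2).
have w_gt0 : 0 < w.
  have /andP[hmin_le hmax_ge] := h_bounds 0%N.
  have e_hmax : 0 < e / hmax < 1 by rewrite divr_gt0 ?ltr_pdivrMr /=; lra.
  rewrite oppr_gt0 derive1_profile_lt0 ?sqr_ge0// exprn_ilt1//; lra.
have we2_gt0 : 0 < w * e ^+ 2 by rewrite mulr_gt0 ?exprn_gt0.
pose B := 2 * (n%:R * - derive1 k 0) * C.
have L_cvg0 : (fun m => B * \sum_a eucnorm (mean_shift_vector k (h m) (X m) a))
    @ \oo --> 0.
  rewrite -[X in _ --> X](mulr0 B); apply: cvgM; first exact: cvg_cst.
  rewrite [X in _ --> X](_ : 0 = \sum_(a < n) 0); last by rewrite big1.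
  by apply: cvg_big => [|a _]; [exact: add_continuous|exact: shift_cvg0].
near=> m.
have [|e_le] := ltP (eucdist (X m i) (X m j)) e; first by left.
right; rewrite ltNge; apply/negP => le_hmin.
have : w * e ^+ 2 <= B * \sum_a eucnorm (mean_shift_vector k (h m) (X m) a).
  apply: le_trans (pair_weight_sqr_eucdist_le profile_k (h m) i j (X_bounded m)).
  apply: ler_pM; [exact: ltW|exact: sqr_ge0|exact: pair_weight_ge hmin_gt0 _ e0 _|].
  by rewrite ler_pXn2r ?nnegrE ?(ltW e0) ?eucnorm_ge0.
by apply/negP; rewrite -ltNge; near: m; exact: (cvgr_lt _ L_cvg0).
Unshelve. all: by end_near. Qed.

Lemma vanishing_shifts_clusters : exists (M : nat) (c : 'I_n -> 'I_M),
  eventual_clusters hmin tau (fun m i j => eucdist (X m i) (X m j)) c.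
Proof.
apply: gap_clusters => //.
- by move=> *; exact: eucnorm_ge0.
- by move=> *; exact: eucdistxx.
- by move=> *; exact: eucdistC.
- by move=> *; exact: eucdist_triangle.
- exact: eucdist_gap.
- exact: eucdist_step_cvg0.
Qed.

End VanishingShifts.

(** * Bandwidths and states of the process *)

Lemma div_sqrt_itv (R : rcfType) (h lo hi a : R) : 0 < h -> 0 < lo -> 0 < hi ->
  (h / hi) ^+ 2 <= a <= (h / lo) ^+ 2 -> lo <= h / Num.sqrt a <= hi.
Proof.
move=> h0 lo0 hi0 /andP[a_ge a_le].
have a0 : 0 < a by apply: lt_le_trans a_ge; rewrite exprn_gt0// divr_gt0.
have sqrt_gt0 : 0 < Num.sqrt a by rewrite sqrtr_gt0.
have sqrt_le : Num.sqrt a <= h / lo.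
  by rewrite -(gtr0_norm (divr_gt0 h0 lo0)) -sqrtr_sqr ler_wsqrtr.
have sqrt_ge : h / hi <= Num.sqrt a.
  by rewrite -(gtr0_norm (divr_gt0 h0 hi0)) -sqrtr_sqr ler_wsqrtr.
rewrite ler_pdivlMr// mulrC -ler_pdivlMr// sqrt_le/=.
by rewrite ler_pdivrMr// mulrC -ler_pdivrMr.
Qed.

Section Bandwidth.
Variables (R : realType) (hmin hmax h1 : R) (nu U : nat -> R).
Hypotheses (hmin_gt0 : 0 < hmin) (hmin_lt : hmin < hmax).
Implicit Types v h u : R.

Lemma dsms_delta_ge0 v h : 0 <= v -> hmin <= h <= hmax ->
  0 <= dsms_delta hmin hmax v h.
Proof.
move=> v0 /andP[hl hu]; have hmax_gt0 := lt_trans hmin_gt0 hmin_lt.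
rewrite !le_min v0 !subr_ge0 /=; apply/andP; split.
  by rewrite exprn_ege1// ler_pdivlMr// mul1r.
by rewrite exprn_ile1// ?ler_pdivrMr ?mul1r ?divr_ge0// ?ltW// (lt_le_trans hmin_gt0).
Qed.

Lemma dsms_delta_le v h : dsms_delta hmin hmax v h <= (h / hmin) ^+ 2 - 1 /\
  dsms_delta hmin hmax v h <= 1 - (h / hmax) ^+ 2.
Proof. by rewrite /dsms_delta !ge_min !lexx !orbT. Qed.

Lemma dsms_delta_le1 v h : dsms_delta hmin hmax v h <= 1.
Proof. by have := (dsms_delta_le v h).2; have := sqr_ge0 (h / hmax); lra. Qed.

Lemma dsms_alpha_bounds v h u : 0 <= v -> hmin <= h <= hmax -> `|u| <= 1 ->
  (h / hmax) ^+ 2 <= 1 + dsms_delta hmin hmax v h * u <= (h / hmin) ^+ 2.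
Proof.
move=> v0 h_bounds u_le1; have [de_hmin de_hmax] := dsms_delta_le v h.
have := dsms_delta_ge0 v0 h_bounds; set de := dsms_delta _ _ _ _ in de_hmin de_hmax *.
move=> de0; have : `|de * u| <= de by rewrite normrM ger0_norm// ler_piMr.
by rewrite ler_norml => /andP[? ?]; apply/andP; lra.
Qed.

Hypothesis h1_bounds : hmin <= h1 <= hmax.
Hypothesis nu_ge0 : forall m, 0 <= nu m.
Hypothesis U_le1 : forall m, `|U m| <= 1.
Local Notation band := (dsms_band hmin hmax h1 nu U).

Lemma dsms_band_bounds m : hmin <= band m <= hmax.
Proof.
elim: m => //= m /[dup] /andP[hmin_le _] band_m.
apply: div_sqrt_itv; last exact: dsms_alpha_bounds.
- exact: lt_le_trans hmin_gt0 hmin_le.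
- exact: hmin_gt0.
- exact: lt_trans hmin_gt0 hmin_lt.
Qed.

Lemma dsms_bandS_sqrV m : (band m.+1)^-1 ^+ 2 =
  (1 + dsms_delta hmin hmax (nu m.+1) (band m) * U m.+1) * (band m)^-1 ^+ 2.
Proof.
have /andP[alpha_ge _] :=
  dsms_alpha_bounds (nu_ge0 m.+1) (dsms_band_bounds m) (U_le1 m.+1).
rewrite /= invfM invrK mulrC exprMn sqr_sqrtr//.
exact: le_trans (sqr_ge0 _) alpha_ge.
Qed.

End Bandwidth.

Lemma dsms_stateS (R : realType) (k : R -> R) (d n : nat) (hmin hmax h1 : R)
    (nu U : nat -> R) (I : nat -> 'I_n) (X0 : 'I_n -> 'rV[R]_d) (m : nat) :
  dsms_state k hmin hmax h1 nu U I X0 m.+1 =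
  move_point k (dsms_band hmin hmax h1 nu U m)
    (dsms_state k hmin hmax h1 nu U I X0 m) (I m).
Proof. by []. Qed.

Lemma eucnorm_dsms_state_le (R : realType) (k : R -> R) (d n : nat)
    (hmin hmax h1 : R) (nu U : nat -> R) (I : nat -> 'I_n) (X0 : 'I_n -> 'rV[R]_d)
    (m : nat) (i : 'I_n) :
  is_profile k ->
  eucnorm (dsms_state k hmin hmax h1 nu U I X0 m i) <= \sum_a eucnorm (X0 a).
Proof.
move=> profile_k; elim: m i => [|m IHm] i; last exact: eucnorm_move_point_le.
by rewrite (bigD1 i)//= lerDl sumr_ge0// => a _; exact: eucnorm_ge0.
Qed.

(** * Measurability *)

Section Measurability.
Variables (dT : measure_display) (T : measurableType dT) (R : realType).

Lemma measurable_fun_invr (f : T -> R) : measurable_fun setT f ->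
  measurable_fun setT (fun w => (f w)^-1).
Proof.
move=> mf.
have -> : (fun w => (f w)^-1) = (fun w => f w * (f w ^+ 2) `^ (-1)).
  apply/funext => w; rewrite powR_inv1 ?sqr_ge0//.
  have [->|f0] := eqVneq (f w) 0; first by rewrite invr0 mul0r.
  by rewrite expr2 invfM mulVKf.
apply: measurable_funM => //.
apply: (measurableT_comp (@measurable_powR R (-1))); exact: measurable_funX.
Qed.

Lemma measurable_fun_sqrtr (f : T -> R) : measurable_fun setT f ->
  measurable_fun setT (fun w => Num.sqrt (f w)).
Proof. exact/(measurableT_comp (continuous_measurable_fun (@sqrt_continuous R))). Qed.

Lemma measurable_fun_eq_cst (S : eqType) (J : T -> S) (a : S) :
  measurable [set w | J w = a] -> measurable_fun setT (fun w => J w == a).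
Proof.
move=> mJ; apply: (measurable_fun_bool true); rewrite setTI.
rewrite (_ : _ @^-1` _ = [set w | J w = a])//.
by apply/seteqP; split=> w /= /eqP.
Qed.

Section RowVectors.
Variable d : nat.
Implicit Types u v : T -> 'rV[R]_d.

Definition measurable_row u : Prop :=
  forall l, measurable_fun setT (fun w => u w ord0 l).

Lemma measurable_rowB u v : measurable_row u -> measurable_row v ->
  measurable_row (fun w => u w - v w).
Proof.
by move=> mu mv l; under eq_fun do rewrite !mxE; exact: measurable_funB.
Qed.

Lemma measurable_rowZ (a : T -> R) u : measurable_fun setT a -> measurable_row u ->
  measurable_row (fun w => a w *: u w).
Proof. by move=> ma mu l; under eq_fun do rewrite mxE; exact: measurable_funM. Qed.

Lemma measurable_row_sum (J : finType) (F : J -> T -> 'rV[R]_d) :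
  (forall j, measurable_row (F j)) -> measurable_row (fun w => \sum_j F j w).
Proof.
move=> mF l; under eq_fun do rewrite summxE.
by apply: measurable_sum => j; exact: mF.
Qed.

Lemma measurable_row_if (b : T -> bool) u v : measurable_fun setT b ->
  measurable_row u -> measurable_row v ->
  measurable_row (fun w => if b w then u w else v w).
Proof.
move=> mb mu mv l; under eq_fun do rewrite (fun_if (fun x : 'rV[R]_d => x ord0 l)).
exact: measurable_fun_ifT.
Qed.

Lemma measurable_eucnorm u : measurable_row u ->
  measurable_fun setT (fun w => eucnorm (u w)).
Proof.
move=> mu; apply: measurable_fun_sqrtr; apply: measurable_sum => l.
exact/measurable_funX/mu.
Qed.

End RowVectors.

Variables (k : R -> R) (n d : nat).
Hypothesis profile_k : is_profile k.

Lemma measurable_kernelK (u : T -> 'rV[R]_d) : measurable_row u ->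
  measurable_fun setT (fun w => kernelK k (u w)).
Proof.
move=> mu; have mk : measurable_fun setT k.
  apply: continuous_measurable_fun => t; case: profile_k => -[derivable_k _] _.
  exact/differentiable_continuous/derivable1_diffP.
exact/(measurableT_comp mk)/measurable_funX/measurable_eucnorm.
Qed.

Lemma measurable_weightG (u : T -> 'rV[R]_d) : measurable_row u ->
  measurable_fun setT (fun w => weightG k (u w)).
Proof.
move=> mu; apply: measurable_funN.
have mk' : measurable_fun setT (derive1 k).
  by apply: continuous_measurable_fun; case: profile_k => -[].
exact/(measurableT_comp mk')/measurable_funX/measurable_eucnorm.
Qed.

Section RandomConfiguration.
Variables (h : T -> R) (X : T -> 'I_n -> 'rV[R]_d).
Hypothesis mh : measurable_fun setT h.
Hypothesis mX : forall i, measurable_row (X ^~ i).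

Lemma measurable_scaled_diff i j :
  measurable_row (fun w => scaled_diff (h w) (X w) i j).
Proof.
by apply: measurable_rowZ; [exact: measurable_fun_invr|exact: measurable_rowB].
Qed.

Lemma measurable_pair_weight i j :
  measurable_fun setT (fun w => pair_weight k (h w) (X w) i j).
Proof. exact/measurable_weightG/measurable_scaled_diff. Qed.

Lemma measurable_mean_shift i :
  measurable_row (fun w => mean_shift k (h w) (X w i) (X w)).
Proof.
apply: measurable_rowZ.
  apply: measurable_fun_invr; apply: measurable_sum => j.
  exact: measurable_pair_weight.
apply: measurable_row_sum => j; apply: measurable_rowZ => //.
exact: measurable_pair_weight.
Qed.

Lemma measurable_eucnorm_mean_shift_vector i :
  measurable_fun setT (fun w => eucnorm (mean_shift_vector k (h w) (X w) i)).
Proof. exact/measurable_eucnorm/measurable_rowB/mX/measurable_mean_shift. Qed.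

Lemma measurable_energy : measurable_fun setT (fun w => energy k (h w) (X w)).
Proof.
do 2 (apply: measurable_sum => ?).
exact/measurable_kernelK/measurable_scaled_diff.
Qed.

Lemma measurable_scaling_drift :
  measurable_fun setT (fun w => scaling_drift k (h w) (X w)).
Proof.
do 2 (apply: measurable_sum => ?); apply: measurable_funM.
  exact: measurable_pair_weight.
exact/measurable_funX/measurable_eucnorm/measurable_scaled_diff.
Qed.

End RandomConfiguration.

Variables (hmin hmax h1 : R) (nu : nat -> R) (X0 : 'I_n -> 'rV[R]_d).
Variables (I : nat -> T -> 'I_n) (U : nat -> T -> R).

Lemma measurable_dsms_delta (v : R) (h : T -> R) : measurable_fun setT h ->
  measurable_fun setT (fun w => dsms_delta hmin hmax v (h w)).
Proof.
move=> mh; apply: measurable_minr; first exact: measurable_cst.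
by apply: measurable_minr; apply: measurable_funB => //;
  apply: measurable_funX; apply: measurable_funM.
Qed.

Lemma measurable_dsms_band m :
  (forall j, (j <= m)%N -> measurable_fun setT (U j)) ->
  measurable_fun setT (fun w => dsms_band hmin hmax h1 nu (U ^~ w) m).
Proof.
elim: m => [|m IHm] mU /=; first exact: measurable_cst.
have mband : measurable_fun setT (fun w => dsms_band hmin hmax h1 nu (U ^~ w) m).
  by apply: IHm => j jm; apply: mU; exact: leqW.
apply: measurable_funM => //; apply/measurable_fun_invr/measurable_fun_sqrtr.
apply: measurable_funD => //; apply: measurable_funM; last exact: mU.
exact: measurable_dsms_delta.
Qed.

Lemma measurable_dsms_state m i :
  (forall j a, (j < m)%N -> measurable [set w | I j w = a]) ->
  (forall j, (j < m)%N -> measurable_fun setT (U j)) ->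
  measurable_row (fun w => dsms_state k hmin hmax h1 nu (U ^~ w) (I ^~ w) X0 m i).
Proof.
elim: m i => [|m IHm] i mI mU; first by move=> l; exact: measurable_cst.
pose X w := dsms_state k hmin hmax h1 nu (U ^~ w) (I ^~ w) X0 m.
have mX a : measurable_row (X ^~ a).
  by apply: IHm => j *; [apply: mI|apply: mU]; exact: leqW.
rewrite (_ : (fun w => _) = fun w => if I m w == i then
    mean_shift k (dsms_band hmin hmax h1 nu (U ^~ w) m) (X w i) (X w) else X w i).
  apply: measurable_row_if => //; first exact/measurable_fun_eq_cst/mI.
  by apply: measurable_mean_shift => //; exact: measurable_dsms_band.
apply/funext => w; rewrite dsms_stateS /move_point [I m w == i]eq_sym.
by case: eqP => [->|_]; reflexivity.
Qed.

End Measurability.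

(** * Independence of a sub-sigma-algebra *)

Section Expectation.
Local Open Scope ereal_scope.
Variables (R : realType) (dT : measure_display) (T : measurableType dT).
Variable P : probability T R.
Implicit Types f g : T -> R.

Lemma ge0_expectationD f g : measurable_fun setT f -> measurable_fun setT g ->
  (forall w, 0 <= f w)%R -> (forall w, 0 <= g w)%R ->
  'E_P[fun w => f w + g w]%R = 'E_P[f] + 'E_P[g].
Proof.
move=> mf mg f0 g0; rewrite unlock; under eq_integral do rewrite EFinD.
by rewrite ge0_integralD//; try exact/measurable_EFinP; move=> w _; rewrite lee_fin.
Qed.

Lemma ge0_expectationZl f (a : R) : measurable_fun setT f ->
  (forall w, 0 <= f w)%R -> (0 <= a)%R ->
  'E_P[fun w => a * f w]%R = a%:E * 'E_P[f].
Proof.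
move=> mf f0 a0; rewrite unlock; under eq_integral do rewrite EFinM.
by rewrite ge0_integralZl//; [exact/measurable_EFinP|move=> w _; rewrite lee_fin].
Qed.

Lemma ge0_expectation_sum (J : finType) (F : J -> T -> R) :
  (forall j, measurable_fun setT (F j)) -> (forall j w, 0 <= F j w)%R ->
  'E_P[fun w => \sum_j F j w]%R = \sum_j 'E_P[F j].
Proof.
move=> mF F0; rewrite unlock; under eq_integral do rewrite -sumEFin.
rewrite ge0_integral_sum// => [j|j w _]; first exact/measurable_EFinP.
by rewrite lee_fin.
Qed.

Lemma ge0_expectation_le f g : measurable_fun setT f -> measurable_fun setT g ->
  (forall w, 0 <= f w)%R -> (forall w, f w <= g w)%R -> 'E_P[f] <= 'E_P[g].
Proof.
move=> mf mg f0 fg; apply: expectation_le => // [w|]; last exact: aeW.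
exact: le_trans (f0 w) (fg w).
Qed.

Lemma ge0_expectation_le_cst f (M : R) : measurable_fun setT f ->
  (forall w, 0 <= f w)%R -> (forall w, f w <= M)%R -> 'E_P[f] <= M%:E.
Proof. by move=> *; rewrite -(expectation_cst P); exact: ge0_expectation_le. Qed.

Lemma bounded_expectation_fin_num f (M : R) : measurable_fun setT f ->
  (forall w, 0 <= f w)%R -> (forall w, f w <= M)%R -> 'E_P[f] \is a fin_num.
Proof.
move=> mf f0 fM; rewrite ge0_fin_numE ?expectation_ge0//.
exact: le_lt_trans (ge0_expectation_le_cst mf f0 fM) (ltry _).
Qed.

End Expectation.

Lemma sum_indic_fibers (R : pzRingType) (T : Type) (V : finType) (J : T -> V)
    (Z : V -> T -> R) (w : T) :
  Z (J w) w = \sum_i Z i w * \1_[set w | J w = i] w.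
Proof.
rewrite (bigD1 (J w))//= indicE mem_set// mulr1 big1 ?addr0// => i /eqP iJ.
by rewrite indicE memNset ?mulr0//= => Jw; exact: iJ.
Qed.

Lemma measurable_fun_select (R : realType) (dT : measure_display)
    (T : measurableType dT) (V : finType) (J : T -> V) (Z : V -> T -> R) :
  (forall i, measurable [set w | J w = i]) ->
  (forall i, measurable_fun setT (Z i)) ->
  measurable_fun setT (fun w => Z (J w) w).
Proof.
move=> mJ mZ; under eq_fun do rewrite sum_indic_fibers.
by apply: measurable_sum => i; apply: measurable_funM.
Qed.

Lemma measure_fibers (R : realFieldType) (dT : measure_display)
    (T : measurableType dT) (mu : {measure set T -> \bar R})
    (n : nat) (J : T -> 'I_n) (A : set T) :
  measurable A -> (forall i, measurable [set w | J w = i]) ->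
  mu A = (\sum_(i < n) mu (A `&` [set w | J w = i]))%E.
Proof.
move=> mA mJ; rewrite -measure_semi_additive_ord.
- congr (mu _); rewrite -bigcup_seq -setI_bigcupr setIidl// => w _ /=.
  by exists (J w) => //=; exact: mem_index_enum.
- by move=> i; exact: measurableI.
- by move=> i j _ _ [w [[_ /= <-] [_ /= <-]]].
- by apply: bigsetU_measurable => i _; exact: measurableI.
Qed.

Section SubSigmaAlgebra.
Local Open Scope ereal_scope.
Variables (R : realType) (dT : measure_display) (T : measurableType dT).
Variables (P : probability T R) (G : set (set T)).
Hypothesis G_measurable : G `<=` measurable.
Local Notation GT := (g_sigma_algebraType G).

Lemma g_sigma_measurable A : <<s G >> A -> measurable A.
Proof. by apply: smallest_sub => //; exact: sigma_algebra_measurable. Qed.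

Lemma measurable_coarsen : measurable_fun setT (id : T -> GT).
Proof. by move=> _ A mA; rewrite setTI; exact: g_sigma_measurable. Qed.

Lemma measurable_refine d' (T' : measurableType d') (f : GT -> T') :
  measurable_fun setT f -> measurable_fun setT (f : T -> T').
Proof. by move=> mf; exact: (measurableT_comp mf measurable_coarsen). Qed.

Lemma eq_integral_g_sigma (mu1 mu2 : {measure set T -> \bar R}) (Z : GT -> \bar R) :
  (forall A, <<s G >> A -> mu1 A = mu2 A) ->
  measurable_fun setT Z -> (forall w, 0 <= Z w) ->
  \int[mu1]_w Z w = \int[mu2]_w Z w.
Proof.
move=> mu12 mZ Z0.
have push (mu : {measure set T -> \bar R}) :
    \int[mu]_w Z w = \int[pushforward mu (id : T -> GT)]_w Z w.
  by rewrite (ge0_integral_pushforward measurable_coarsen).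
rewrite !push; apply: eq_measure_integral => [||m1 m2 A mA _]; last exact: mu12.
all: exact: measurable_coarsen.
Qed.

Lemma integral_mrestr (mu : {measure set T -> \bar R}) (D : set T)
    (mD : measurable D) (f : T -> \bar R) :
  measurable_fun setT f -> (forall w, 0 <= f w) ->
  \int[mrestr mu mD]_w f w = \int[mu]_(w in D) f w.
Proof.
move=> mf f0; rewrite (@ge0_negligible_integral _ _ _ (mrestr mu mD) setT (~` D))//.
- rewrite setTD setCK; apply: eq_measure_integral => A mA AD.
  by rewrite /= /mrestr setIidl.
- exact: measurableC.
- by rewrite /= /mrestr setICl measure0.
Qed.

Lemma g_sigma_proportional (D : set T) (c : {nonneg R}) (g : (set T)^nat) :
  measurable D -> setI_closed G -> (forall m, G (g m)) -> \bigcup_m g m = setT ->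
  (forall A, G A -> P (A `&` D) = c%:num%:E * P A) ->
  forall A, <<s G >> A -> P (A `&` D) = c%:num%:E * P A.
Proof.
move=> mD G_setI Gg g_cover PD.
apply: (g_sigma_algebra_measure_unique G _ g Gg g_cover
  (mrestr P mD) (mscale c P)) => // m.
apply: le_lt_trans (ltry 1%R); apply: probability_le1.
by apply: measurableI => //; exact: G_measurable.
Qed.

Lemma expectation_indic_proportional (D : set T) (c : {nonneg R}) (Z : GT -> R) :
  measurable D ->
  (forall A, <<s G >> A -> P (A `&` D) = c%:num%:E * P A) ->
  measurable_fun setT Z -> (forall w, 0 <= Z w)%R ->
  'E_P[fun w => Z w * \1_D w]%R = c%:num%:E * 'E_P[Z].
Proof.
move=> mD PD mZ Z0; have mZ' := measurable_refine mZ; rewrite unlock.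
rewrite -ge0_integral_mscale//; last 2 first.
- exact/measurable_EFinP.
- by move=> w _; rewrite lee_fin.
rewrite -(@eq_integral_g_sigma (mrestr P mD) (mscale c P) (EFin \o Z))//.
- rewrite integral_mrestr//; last exact/measurable_EFinP.
  by rewrite integral_mkcond; apply: eq_integral => w _; rewrite epatch_indic EFinM.
- exact/measurable_EFinP.
Qed.

Definition independent_with_law (d2 : measure_display) (T2 : measurableType d2)
    (V : T -> T2) (Q : probability T2 R) : Prop :=
  forall A B, <<s G >> A -> measurable B -> P (A `&` V @^-1` B) = P A * Q B.

Lemma expectationM_independent (d2 : measure_display) (T2 : measurableType d2)
    (V : T -> T2) (Q : probability T2 R) (Z : GT -> R) (F : T2 -> R) :
  measurable_fun setT V -> independent_with_law V Q ->
  measurable_fun setT Z -> (forall w, 0 <= Z w)%R ->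
  measurable_fun setT F -> (forall x, 0 <= F x)%R ->
  'E_P[fun w => Z w * F (V w)]%R = 'E_P[Z] * 'E_Q[F].
Proof.
move=> mV indep mZ Z0 mF F0; have mZ' := measurable_refine mZ; rewrite unlock.
pose idG : {mfun T >-> GT} := HB.pack (id : T -> GT)
  (isMeasurableFun.Build _ _ _ _ _ measurable_coarsen).
have mW : measurable_fun setT (fun w : T => ((w : GT), V w)).
  by apply: measurable_fun_pair => //; exact: measurable_coarsen.
pose W : {mfun T >-> (GT * T2)%type} := HB.pack (fun w : T => ((w : GT), V w))
  (isMeasurableFun.Build _ _ _ _ _ mW).
pose ZF (z : GT * T2) := (Z z.1 * F z.2)%:E.
have mZF : measurable_fun setT ZF.
  apply/measurable_EFinP; apply: measurable_funM.
    exact: (measurableT_comp mZ measurable_fst).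
  exact: (measurableT_comp mF measurable_snd).
have ZF0 z : 0 <= ZF z by rewrite lee_fin mulr_ge0.
transitivity (\int[distribution P W]_z ZF z).
  by rewrite ge0_integral_pushforward.
transitivity (\int[distribution P idG \x Q]_z ZF z).
  apply: eq_measure_integral => A mA _; apply/esym.
  exact: product_measure_unique.
have section_integral (x : GT) :
    \int[Q]_y ZF (x, y) = (Z x)%:E * \int[Q]_y (F y)%:E.
  rewrite /ZF/=; under eq_integral do rewrite EFinM.
  rewrite ge0_integralZl ?lee_fin// => [|y _]; first exact/measurable_EFinP.
  by rewrite lee_fin.
rewrite fubini_tonelli1//; under eq_integral do rewrite /fubini_F section_integral.
rewrite ge0_integralZr//.
- rewrite (ge0_integral_pushforward measurable_coarsen)//; first exact/measurable_EFinP.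
  by move=> x _; rewrite lee_fin.
- exact/measurable_EFinP.
- by move=> x _; rewrite lee_fin.
- by apply: integral_ge0 => y _; rewrite lee_fin.
Qed.

End SubSigmaAlgebra.

(** * The driving noise *)

Section UniformLaw.
Variable R : realType.

Lemma uniform_prob_itvoo (a b : R) (ab : a < b) (B : set R) : measurable B ->
  uniform_prob ab B = (lebesgue_measure (B `&` `]a, b[) * (b - a)^-1%:E)%E.
Proof.
move=> mB; rewrite /uniform_prob integral_uniform_pdf.
have mBoo : measurable (B `&` `]a, b[) by apply: measurableI.
have mBcc : measurable (B `&` `[a, b]) by apply: measurableI.
rewrite (eq_integral (fun=> (b - a)^-1%:E)); last first.
  by move=> x; rewrite inE => -[_]; rewrite /= in_itv/= /uniform_pdf => ->.
rewrite integral_cst// muleC; congr (_ * _)%E.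
have BccE : B `&` `[a, b] = (B `&` `]a, b[) `|` (B `&` [set a; b]).
  by rewrite -setIUr setUA (setUC `]a, b[) setU1itv ?bnd_simp// setUitv1 ?bnd_simp ?ltW.
have ends0 : lebesgue_measure (B `&` [set a; b]) = 0%E.
  exact/countable_lebesgue_measure0/finite_set_countable/finite_setIr/finite_set2.
by rewrite BccE measureU0//; apply: measurableI => //; apply: measurableU.
Qed.

Lemma ltN11 : -1 < 1 :> R. Proof. by lra. Qed.

(* Almost surely [cutoff] does not change the noise; it makes the bounds on the
   bandwidths hold for every outcome. *)
Definition cutoff (u : R) : R := if `|u| <= 1 then u else 0.

Lemma cutoff_le1 u : `|cutoff u| <= 1.
Proof. by rewrite /cutoff; case: ifP => //; rewrite normr0. Qed.

Lemma cutoffD1_ge0 u : 0 <= 1 + cutoff u.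
Proof. by have := cutoff_le1 u; rewrite ler_norml => /andP[]; lra. Qed.

Lemma measurable_cutoff : measurable_fun setT cutoff.
Proof.
apply: measurable_fun_ifT => //.
by apply: measurable_fun_ler => //; exact: measurableT_comp.
Qed.

Lemma measurable_cutoffD1 : measurable_fun setT (fun u => 1 + cutoff u).
Proof. by apply: measurable_funD => //; exact: measurable_cutoff. Qed.

Lemma expectation_uniform_cutoffD1 :
  ('E_(uniform_prob ltN11)[fun u => (1 + cutoff u)%R] = 1)%E.
Proof.
rewrite unlock integral_uniform; last 2 first.
- by apply/measurable_EFinP; exact: measurable_cutoffD1.
- by move=> x; rewrite lee_fin cutoffD1_ge0.
under eq_integral => x.
  by rewrite inE/= in_itv/= => x11; rewrite /cutoff ler_norml x11; over.
pose F (x : R) := x + 2^-1 * x ^+ 2.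
have dF (x : R) : is_derive x 1 F (1 + x).
  by rewrite /F; apply: is_derive_eq; rewrite /GRing.scale/=; lra.
have cF x : {for x, continuous F}.
  by apply/differentiable_continuous/derivable1_diffP; case: (dF x).
rewrite (@continuous_FTC2 R (fun x => 1 + x) F); first last.
- by move=> x _; rewrite derive1E; exact: derive_val.
- split=> [x _| |]; first by case: (dF x).
    exact/cvg_at_right_filter/cF.
  exact/cvg_at_left_filter/cF.
- by apply: continuous_subspaceT => x; apply: cvgD; [exact: cvg_cst|exact: cvg_id].
- exact: ltN11.
by rewrite /F -EFinB -EFinM; congr EFin; field.
Qed.

End UniformLaw.

Section Noise.
Local Open Scope ereal_scope.
Variables (R : realType) (dT : measure_display) (T : measurableType dT).
Variables (P : probability T R) (n : nat).
Variables (I : nat -> T -> 'I_n) (U : nat -> T -> R).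
Hypothesis n_gt0 : (0 < n)%N.
Hypothesis noise : dsms_noise P I U.
Local Notation unif := (uniform_prob (ltN11 R)).
Implicit Types (a : nat -> 'I_n) (B : nat -> set R).

Definition cylinder p q a B : set T :=
  (\big[setI/setT]_(j < p) [set w | I j w = a j]) `&`
  (\big[setI/setT]_(j < q) (U j @^-1` B j)).

(* The information carried by [I_0, ..., I_(p-1)] and [U_0, ..., U_(q-1)]; the two
   lengths differ by one between the draw of a bandwidth and that of an index. *)
Definition past p q : set (set T) :=
  [set A | A = set0 \/
    exists a B, (forall m, measurable (B m)) /\ A = cylinder p q a B].

Lemma cylinderP p q a B w : cylinder p q a B w <->
  (forall j, (j < p)%N -> I j w = a j) /\ (forall j, (j < q)%N -> B j (U j w)).
Proof.
rewrite /cylinder -(bigcap_mkord _ (fun j => [set w | I j w = a j])).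
by rewrite -(bigcap_mkord _ (fun j => U j @^-1` B j)).
Qed.

Lemma measurable_index m i : measurable [set w | I m w = i].
Proof. by case: noise. Qed.

Lemma measurable_noise m : measurable_fun setT (U m).
Proof. by case: noise => _ []. Qed.

Lemma measurable_noise_preimage m (S : set R) :
  measurable S -> measurable (U m @^-1` S).
Proof. by move=> mS; rewrite -[X in measurable X]setTI; exact: measurable_noise. Qed.

Lemma measurable_cylinder p q a B : (forall m, measurable (B m)) ->
  measurable (cylinder p q a B).
Proof.
move=> mB; apply: measurableI; apply: bigsetI_measurable => j _.
  exact: measurable_index.
exact: measurable_noise_preimage.
Qed.

Lemma past_measurable p q : past p q `<=` measurable.
Proof. by move=> _ [->//|[a [B [mB ->]]]]; exact: measurable_cylinder. Qed.

Lemma past_setI p q : setI_closed (past p q).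
Proof.
move=> A A' [->|[a [B [mB ->]]]]; first by left; rewrite set0I.
move=> [->|[a' [B' [mB' ->]]]]; first by left; rewrite setI0.
have [aa'|aa'] := pselect (forall j, (j < p)%N -> a j = a' j).
  right; exists a, (fun j => B j `&` B' j).
  split=> [m|]; first exact: measurableI.
  rewrite /cylinder setIACA big_split; congr (_ `&` _).
  by rewrite -[RHS]setIid; congr (_ `&` _); apply: eq_bigr => j _; rewrite aa'.
left; rewrite -subset0 => w [/cylinderP[aw _] /cylinderP[a'w _]].
by apply: aa' => j jp; rewrite -aw// a'w.
Qed.

Definition enum_assignment (m : nat) : nat -> 'I_n :=
  nth (Ordinal n_gt0) (odflt [::] (unpickle m)).

Lemma enum_assignment_surj p a :
  exists m, forall j, (j < p)%N -> enum_assignment m j = a j.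
Proof.
exists (pickle (mkseq a p)) => j jp.
by rewrite /enum_assignment pickleK /= nth_mkseq.
Qed.

Definition index_cylinder p q m : set T :=
  cylinder p q (enum_assignment m) (fun=> setT).

Lemma past_index_cylinder p q m : past p q (index_cylinder p q m).
Proof. by right; exists (enum_assignment m), (fun=> setT). Qed.

Lemma index_cylinder_cover p q : \bigcup_m index_cylinder p q m = setT.
Proof.
rewrite -subTset => w _; have [m mE] := enum_assignment_surj p (I ^~ w).
by exists m => //; apply/cylinderP; split=> // j jp; rewrite mE.
Qed.

Lemma past_index p q j i : (j < p)%N -> <<s past p q >> [set w | I j w = i].
Proof.
move=> jp.
have -> : [set w | I j w = i] =
    \bigcup_(m in [set m | enum_assignment m j = i]) index_cylinder p q m.
  apply/seteqP; split=> w; last by move=> [m /= <- /cylinderP[-> //]].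
  move=> Ijw; have [m mE] := enum_assignment_surj p (I ^~ w).
  by exists m; rewrite /= ?mE//; apply/cylinderP; split=> // l lp; rewrite mE.
apply: (@bigcup_measurable _ (g_sigma_algebraType (past p q))) => m _.
by apply: sub_sigma_algebra; exact: past_index_cylinder.
Qed.

Lemma past_noise p q j (S : set R) : (j < q)%N -> measurable S ->
  <<s past p q >> (U j @^-1` S).
Proof.
move=> jq mS; pose B := [eta (fun=> setT) with j |-> S] : nat -> set R.
have -> : U j @^-1` S = \bigcup_m cylinder p q (enum_assignment m) B.
  apply/seteqP; split=> w; last first.
    by move=> [m _ /cylinderP[_ /(_ j jq)]]; rewrite /B/= eqxx.
  move=> Sw; have [m mE] := enum_assignment_surj p (I ^~ w).
  exists m => //; apply/cylinderP; split=> [l lp|l _]; first by rewrite mE.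
  by rewrite /B/=; case: eqP => [->|].
apply: (@bigcup_measurable _ (g_sigma_algebraType (past p q))) => m _.
apply: sub_sigma_algebra; right; exists (enum_assignment m), B; split=> // l.
by rewrite /B/=; case: eqP.
Qed.

Lemma cylinder_prob N a B : (forall m, measurable (B m)) ->
  P (cylinder N N a B) = \prod_(m < N) (n%:R^-1%:E * unif (B m)).
Proof.
move=> mB; case: noise => _ [_ /(_ N a B mB)].
rewrite bigcap_mkord big_split => ->; apply: eq_bigr => m _.
by rewrite uniform_prob_itvoo// opprK.
Qed.

Lemma cylinder_index N q a B i : cylinder N q a B `&` [set w | I N w = i] =
  cylinder N.+1 q [eta a with N |-> i] B.
Proof.
rewrite /cylinder big_ord_recr/= eqxx setIAC; congr (_ `&` _ `&` _).
by apply: eq_bigr => j _; rewrite ltn_eqF.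
Qed.

Lemma cylinder_noise p N a B S : cylinder p N a B `&` U N @^-1` S =
  cylinder p N.+1 a [eta B with N |-> S].
Proof.
rewrite /cylinder big_ord_recr/= eqxx setIA; congr (_ `&` _ `&` _).
by apply: eq_bigr => j _; rewrite ltn_eqF.
Qed.

Lemma cylinder_index_prob N a B i : (forall m, measurable (B m)) ->
  P (cylinder N N.+1 a B `&` [set w | I N w = i]) =
  P (cylinder N N a B) * (n%:R^-1%:E * unif (B N)).
Proof. by move=> mB; rewrite cylinder_index !cylinder_prob// big_ord_recr. Qed.

Lemma cylinder_noise_prob N a B : (forall m, measurable (B m)) ->
  P (cylinder N N.+1 a B) = P (cylinder N N a B) * unif (B N).
Proof.
move=> mB; rewrite (@measure_fibers _ _ _ P n (I N)).
- rewrite (eq_bigr (fun=> P (cylinder N N a B) * (n%:R^-1%:E * unif (B N))));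
    last by move=> i _; exact: cylinder_index_prob.
  rewrite sumr_const card_ord -[LHS]mule_natl muleCA [X in _ * X]muleA -EFinM.
  by rewrite divff ?mul1e// pnatr_eq0 -lt0n.
- exact: measurable_cylinder.
- exact: measurable_index.
Qed.

Lemma past_proportional p q (D : set T) (c : {nonneg R}) : measurable D ->
  (forall a B, (forall m, measurable (B m)) ->
    P (cylinder p q a B `&` D) = c%:num%:E * P (cylinder p q a B)) ->
  forall A, <<s past p q >> A -> P (A `&` D) = c%:num%:E * P A.
Proof.
move=> mD PD; apply: (@g_sigma_proportional _ _ _ P _ (@past_measurable p q) D c
  (index_cylinder p q)) => //.
- exact: past_setI.
- exact: past_index_cylinder.
- exact: index_cylinder_cover.
- move=> _ [->|[a [B [mB ->]]]]; last exact: PD.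
  by rewrite set0I measure0 mule0.
Qed.

Lemma past_index_prob N A i : <<s past N N.+1 >> A ->
  P (A `&` [set w | I N w = i]) = n%:R^-1%:E * P A.
Proof.
have n0 : (0 <= n%:R^-1 :> R)%R by rewrite invr_ge0.
apply: (past_proportional (c := NngNum n0)) => [|a B mB].
  exact: measurable_index.
by rewrite cylinder_index_prob// cylinder_noise_prob// muleCA.
Qed.

Lemma independent_past_noise N :
  independent_with_law P (past N N) (U N : T -> measurableTypeR R) unif.
Proof.
move=> A S sA mS; have unif0 : (0 <= fine (unif S))%R by exact: fine_ge0.
have unifE : (fine (unif S))%:E = unif S by rewrite fineK// fin_num_measure.
rewrite muleC -[X in X * _]unifE.
apply: (past_proportional (c := NngNum unif0)) sA => [|a B mB].
  exact: measurable_noise_preimage.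
have mBS m : measurable ([eta B with N |-> S] m).
  by rewrite /=; case: eqP => _; [exact: mS|exact: mB].
rewrite cylinder_noise cylinder_noise_prob//= unifE eqxx muleC; congr (_ * P _).
by rewrite /cylinder; congr (_ `&` _); apply: eq_bigr => j _; rewrite /= ltn_eqF.
Qed.

Lemma ae_cutoff_noise : {ae P, forall w, forall m, cutoff (U m w) = U m w}.
Proof.
apply/ae_foralln => m; have mO : measurable (~` @open_m1_1 R).
  by apply: measurableC; exact: measurable_itv.
exists (U m @^-1` ~` @open_m1_1 R); split.
- exact: measurable_noise_preimage.
- transitivity (P (setT `&` U m @^-1` ~` @open_m1_1 R)); first by rewrite setTI.
  rewrite independent_past_noise//; last first.
    exact: (@measurableT _ (g_sigma_algebraType (past m m))).
  rewrite [X in _ * X](_ : _ = 0) ?mule0//.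
  by apply: etrans (uniform_prob_itvoo _ mO) _; rewrite setICl measure0 mul0e.
- move=> w /= cut_neq; rewrite /open_m1_1/= in_itv/= => /andP[u1 u2]; apply: cut_neq.
  by rewrite /cutoff ler_norml !ltW.
Qed.

Lemma expectation_selected N (Z : 'I_n -> T -> R) :
  (forall i, measurable_fun setT (Z i : g_sigma_algebraType (past N N.+1) -> R)) ->
  (forall i w, 0 <= Z i w)%R ->
  'E_P[fun w => Z (I N w) w] = n%:R^-1%:E * 'E_P[fun w => \sum_i Z i w]%R.
Proof.
move=> mZ Z0; have n0 : (0 <= n%:R^-1 :> R)%R by rewrite invr_ge0.
have mZ' i : measurable_fun setT (Z i).
  by apply: (measurable_refine (@past_measurable N N.+1)); exact: mZ.
under eq_fun do rewrite (sum_indic_fibers (I N)).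
rewrite !ge0_expectation_sum//; last 2 first.
- move=> i; apply: measurable_funM => //; apply: measurable_indic.
  exact: measurable_index.
- by move=> i w; rewrite mulr_ge0.
rewrite ge0_sume_distrr => [|i _]; last exact: expectation_ge0.
apply: eq_bigr => i _.
apply: (expectation_indic_proportional (@past_measurable N N.+1)
  (c := NngNum n0)) => //.
- exact: measurable_index.
- by move=> A; exact: past_index_prob.
Qed.

Lemma expectation_noise N (Z : T -> R) :
  measurable_fun setT (Z : g_sigma_algebraType (past N N) -> R) ->
  (forall w, 0 <= Z w)%R ->
  'E_P[fun w => Z w * (1 + cutoff (U N w))]%R = 'E_P[Z].
Proof.
move=> mZ Z0; rewrite (expectationM_independent (T2 := measurableTypeR R)
  (@past_measurable N N) (measurable_noise N) (@independent_past_noise N)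
  (F := fun u => 1 + cutoff u)%R)//.
- by rewrite expectation_uniform_cutoffD1 mule1.
- exact: measurable_cutoffD1.
- exact: cutoffD1_ge0.
Qed.

End Noise.

(** * Almost sure convergence *)

Section SummableExpectations.
Local Open Scope ereal_scope.
Variables (R : realType) (dT : measure_display) (T : measurableType dT).
Variable P : probability T R.

Lemma nneseries_fin_num_cvg0 (u : R^nat) : (forall m, 0 <= u m)%R ->
  \sum_(m <oo) (u m)%:E \is a fin_num -> u @ \oo --> 0%R.
Proof.
move=> u0 fin; apply: cvg_series_cvg_0; apply: nondecreasing_is_cvgn.
  by apply: nondecreasing_series => m _ _.
exists (fine (\sum_(m <oo) (u m)%:E)) => _ [N _ <-].
rewrite -lee_fin fineK// /series/= -sumEFin.
by apply: nneseries_lim_ge => m _; rewrite lee_fin.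
Qed.

Lemma ae_cvg0_of_summable (D : nat -> T -> R) (C : R) :
  (forall m, measurable_fun setT (D m)) -> (forall m w, 0 <= D m w)%R ->
  (forall N, \sum_(m < N) 'E_P[D m] <= C%:E) ->
  {ae P, forall w, D ^~ w @ \oo --> 0%R}.
Proof.
move=> mD D0 DC.
have intE m : \int[P]_w (D m w)%:E = 'E_P[D m] by rewrite unlock.
have mED m : measurable_fun setT (fun w => (D m w)%:E) by exact/measurable_EFinP.
have ED0 m w : 0 <= (D m w)%:E by rewrite lee_fin.
have int_series : P.-integrable setT (fun w => \sum_(m <oo) (D m w)%:E).
  apply/integrableP; split; first exact: ge0_emeasurable_sum.
  under eq_integral do rewrite gee0_abs ?nneseries_ge0//.
  rewrite integral_nneseries//; apply: le_lt_trans (ltry C); apply: lime_le.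
    by apply: is_cvg_nneseries => m _ _; exact: integral_ge0.
  by near=> N; rewrite big_mkord; under eq_bigr do rewrite intE; exact: DC.
apply: filterS (integrable_ae measurableT int_series) => w /(_ Logic.I).
exact: nneseries_fin_num_cvg0.
Unshelve. all: by end_near. Qed.

Lemma ae_cvg0_of_drift (E D : nat -> T -> R) (c M : R) : (0 < c)%R ->
  (forall m, measurable_fun setT (E m)) -> (forall m w, 0 <= E m w <= M)%R ->
  (forall m, measurable_fun setT (D m)) -> (forall m w, 0 <= D m w)%R ->
  (forall m, 'E_P[E m] + c%:E * 'E_P[D m] <= 'E_P[E m.+1]) ->
  {ae P, forall w, D ^~ w @ \oo --> 0%R}.
Proof.
move=> c0 mE EM mD D0 drift.
have E0 m w : (0 <= E m w)%R by case/andP: (EM m w).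
have sum_le N : 'E_P[E 0%N] + c%:E * \sum_(m < N) 'E_P[D m] <= 'E_P[E N].
  elim: N => [|N IHN]; first by rewrite big_ord0 mule0 adde0.
  rewrite big_ord_recr/= ge0_muleDr ?expectation_ge0 ?sume_ge0// => [|m _].
    by rewrite addeA; apply: le_trans (drift N); exact: leeD2r.
  exact: expectation_ge0.
apply: (@ae_cvg0_of_summable D (c^-1 * M)) => // N.
rewrite EFinM lee_pdivlMl//.
apply: (@le_trans _ _ 'E_P[E N]).
  by apply: le_trans (sum_le N); rewrite leeDr ?expectation_ge0.
by apply: ge0_expectation_le_cst => // w; case/andP: (EM N w).
Qed.

End SummableExpectations.

Section Process.
Variables (R : realType) (dT : measure_display) (T : measurableType dT).
Variables (P : probability T R) (n d : nat) (k : R -> R) (hmin hmax h1 : R).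
Variables (nu : nat -> R) (X0 : 'I_n -> 'rV[R]_d).
Variables (I : nat -> T -> 'I_n) (U : nat -> T -> R).
Hypothesis n_gt0 : (0 < n)%N.
Hypothesis profile_k : is_profile k.
Hypotheses (hmin_gt0 : 0 < hmin) (hmin_lt : hmin < hmax).
Hypothesis h1_bounds : hmin <= h1 <= hmax.
Hypothesis nu_ge0 : forall m, 0 <= nu m.
Hypothesis noise : dsms_noise P I U.

Definition cut_noise m w : R := cutoff (U m w).

Definition bandwidth m w : R := dsms_band hmin hmax h1 nu (cut_noise ^~ w) m.

Definition state m w : 'I_n -> 'rV[R]_d :=
  dsms_state k hmin hmax h1 nu (cut_noise ^~ w) (I ^~ w) X0 m.

Definition sqr_shift m i w : R :=
  eucnorm (mean_shift_vector k (bandwidth m w) (state m w) i) ^+ 2.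

Definition state_energy m w : R := energy k (bandwidth m w) (state m w).

Definition moved_energy m w : R := energy k (bandwidth m w) (state m.+1 w).

Definition bandwidth_drift m w : R :=
  scaling_drift k (bandwidth m w) (state m.+1 w) *
  dsms_delta hmin hmax (nu m.+1) (bandwidth m w).

Lemma bandwidth_bounds m w : hmin <= bandwidth m w <= hmax.
Proof. by apply: dsms_band_bounds => // j; exact: cutoff_le1. Qed.

Lemma state_energy_bounds m w : 0 <= state_energy m w <= n%:R ^+ 2 * k 0.
Proof. by rewrite energy_ge0// energy_le. Qed.

Lemma bandwidth_drift_ge0 m w : 0 <= bandwidth_drift m w.
Proof.
rewrite mulr_ge0 ?scaling_drift_ge0//.
exact: dsms_delta_ge0 (nu_ge0 _) (bandwidth_bounds _ _).
Qed.

Lemma bandwidth_drift_le m w : bandwidth_drift m w <= n%:R ^+ 2 * k 0.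
Proof.
apply: le_trans (scaling_drift_le profile_k (bandwidth m w) (state m.+1 w)).
by rewrite -[leRHS]mulr1 ler_wpM2l ?scaling_drift_ge0// dsms_delta_le1.
Qed.

Definition shift_gain : R := hmax^-1 ^+ 2 * - derive1 k 0.

Lemma shift_gain_gt0 : 0 < shift_gain.
Proof.
have hmax_gt0 := lt_trans hmin_gt0 hmin_lt.
by rewrite mulr_gt0 ?exprn_gt0 ?invr_gt0// oppr_gt0 derive1_profile_lt0.
Qed.

Lemma state_energy_move m w :
  state_energy m w + shift_gain * sqr_shift m (I m w) w <= moved_energy m w.
Proof.
apply: le_trans (energy_move_point profile_k (bandwidth m w) (state m w) (I m w)).
have /andP[hmin_le hmax_ge] := bandwidth_bounds m w.
have h_gt0 : 0 < bandwidth m w by exact: lt_le_trans hmin_le.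
have inv_le : hmax^-1 ^+ 2 <= (bandwidth m w)^-1 ^+ 2.
  have hmax_gt0 := lt_trans hmin_gt0 hmin_lt.
  by rewrite ler_pXn2r ?nnegrE ?invr_ge0 ?lef_pV2 ?posrE// ltW.
have weight_le : - derive1 k 0 * sqr_shift m (I m w) w <=
    total_weight k (bandwidth m w) (state m w) (I m w) * sqr_shift m (I m w) w.
  by rewrite ler_wpM2r ?sqr_ge0// total_weight_ge.
have weight_ge0 : 0 <= - derive1 k 0 * sqr_shift m (I m w) w.
  by rewrite mulr_ge0 ?sqr_ge0// oppr_ge0 derive1_profile_le0.
have := ler_pM (sqr_ge0 _) weight_ge0 inv_le weight_le.
have := mulr_ge0 (sqr_ge0 hmax^-1) weight_ge0.
by rewrite lerD2l /shift_gain -/(sqr_shift m (I m w) w); lra.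
Qed.

Lemma moved_energy_rescale m w : moved_energy m w + bandwidth_drift m w <=
  state_energy m.+1 w + bandwidth_drift m w * (1 + cut_noise m.+1 w).
Proof.
have hE := dsms_bandS_sqrV hmin_gt0 hmin_lt h1_bounds nu_ge0
  (fun j => cutoff_le1 (U j w)) m.
have : moved_energy m w - scaling_drift k (bandwidth m w) (state m.+1 w) *
    (dsms_delta hmin hmax (nu m.+1) (bandwidth m w) * cut_noise m.+1 w)
    <= state_energy m.+1 w by exact: energy_rescale.
by rewrite /bandwidth_drift; lra.
Qed.

Local Notation history p q := (g_sigma_algebraType (past I U p q)).

Lemma cut_noise_adapted p q m : (m < q)%N ->
  measurable_fun setT (cut_noise m : history p q -> R).
Proof.
move=> mq; apply: (measurableT_comp (@measurable_cutoff R)) => _ B mB.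
by rewrite setTI; exact: past_noise.
Qed.

Lemma bandwidth_adapted p q m : (m < q)%N ->
  measurable_fun setT (bandwidth m : history p q -> R).
Proof.
move=> mq; apply: (@measurable_dsms_band _ (history p q)) => j jm.
by apply: cut_noise_adapted; exact: leq_ltn_trans mq.
Qed.

Lemma state_adapted p q m i : (m <= p)%N -> (m <= q)%N ->
  @measurable_row _ (history p q) R d (state m ^~ i).
Proof.
move=> mp mq; apply: (@measurable_dsms_state _ (history p q)) => // j.
  by move=> a jm; apply: past_index => //; exact: leq_trans mp.
by move=> jm; apply: cut_noise_adapted; exact: leq_trans mq.
Qed.

Lemma sqr_shift_adapted m i :
  measurable_fun setT (sqr_shift m i : history m m.+1 -> R).
Proof.
apply: measurable_funX.
apply: (@measurable_eucnorm_mean_shift_vector _ (history m m.+1)) => //.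
  exact: bandwidth_adapted.
by move=> a; exact: state_adapted.
Qed.

Lemma bandwidth_drift_adapted m :
  measurable_fun setT (bandwidth_drift m : history m.+1 m.+1 -> R).
Proof.
have mband := @bandwidth_adapted m.+1 m.+1 m (leqnn _).
apply: measurable_funM; last exact: measurable_dsms_delta.
apply: (@measurable_scaling_drift _ (history m.+1 m.+1)) => // i.
exact: state_adapted.
Qed.

Lemma adapted_measurable p q (f : T -> R) :
  measurable_fun setT (f : history p q -> R) -> measurable_fun setT f.
Proof. by apply: measurable_refine; exact: (past_measurable noise). Qed.

Lemma measurable_bandwidth m : measurable_fun setT (bandwidth m).
Proof. exact: adapted_measurable (@bandwidth_adapted m m.+1 m (leqnn _)). Qed.

Lemma measurable_state m i : measurable_row (state m ^~ i).
Proof.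
by move=> l; exact: adapted_measurable (state_adapted i (leqnn m) (leqnn m) l).
Qed.

Lemma measurable_sqr_shift m i : measurable_fun setT (sqr_shift m i).
Proof. exact: adapted_measurable (@sqr_shift_adapted m i). Qed.

Lemma measurable_bandwidth_drift m : measurable_fun setT (bandwidth_drift m).
Proof. exact: adapted_measurable (@bandwidth_drift_adapted m). Qed.

Lemma measurable_state_energy m : measurable_fun setT (state_energy m).
Proof.
apply: measurable_energy => // [|i]; first exact: measurable_bandwidth.
exact: measurable_state.
Qed.

Lemma measurable_moved_energy m : measurable_fun setT (moved_energy m).
Proof.
apply: measurable_energy => // [|i]; first exact: measurable_bandwidth.
exact: measurable_state.
Qed.

Local Open Scope ereal_scope.

Lemma expectation_move m : 'E_P[state_energy m] +
  (shift_gain / n%:R)%:E * 'E_P[fun w => \sum_i sqr_shift m i w]%R <=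
  'E_P[moved_energy m].
Proof.
have g_ge0 := ltW shift_gain_gt0.
have shift_ge0 i w : (0 <= sqr_shift m i w)%R by exact: sqr_ge0.
have e_ge0 w : (0 <= state_energy m w)%R by exact: energy_ge0.
have mshift : measurable_fun setT (fun w => sqr_shift m (I m w) w).
  exact: measurable_fun_select (measurable_index noise m) (measurable_sqr_shift m).
have mgain : measurable_fun setT (fun w => shift_gain * sqr_shift m (I m w) w)%R.
  exact: measurable_funM.
rewrite EFinM -muleA.
rewrite -(expectation_selected n_gt0 noise (@sqr_shift_adapted m) shift_ge0).
rewrite -ge0_expectationZl// -ge0_expectationD//; last 2 first.
- exact: measurable_state_energy.
- by move=> w; exact: mulr_ge0 g_ge0 (shift_ge0 _ w).
apply: ge0_expectation_le.
- by apply: measurable_funD => //; exact: measurable_state_energy.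
- exact: measurable_moved_energy.
- by move=> w; exact: addr_ge0 (e_ge0 w) (mulr_ge0 g_ge0 (shift_ge0 _ w)).
- exact: state_energy_move.
Qed.

Lemma expectation_rescale m : 'E_P[moved_energy m] <= 'E_P[state_energy m.+1].
Proof.
have mdrift := measurable_bandwidth_drift m.
have drift_ge0 := bandwidth_drift_ge0 m.
have fin := bounded_expectation_fin_num P mdrift drift_ge0 (bandwidth_drift_le m).
have mme := measurable_moved_energy m; have mse := measurable_state_energy m.+1.
have me_ge0 w : (0 <= moved_energy m w)%R by exact: energy_ge0.
have mnoise : measurable_fun setT
    (fun w => bandwidth_drift m w * (1 + cut_noise m.+1 w))%R.
  apply: measurable_funM => //.
  exact: (measurableT_comp (@measurable_cutoffD1 R) (measurable_noise noise m.+1)).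
rewrite -(leeD2rE _ _ fin).
rewrite -{2}(expectation_noise n_gt0 noise (@bandwidth_drift_adapted m) drift_ge0).
rewrite -!ge0_expectationD//; last 2 first.
- by move=> w; exact: energy_ge0.
- by move=> w; rewrite mulr_ge0 ?cutoffD1_ge0.
apply: ge0_expectation_le; [exact: measurable_funD|exact: measurable_funD| |].
- by move=> w; rewrite addr_ge0.
- exact: moved_energy_rescale.
Qed.

Lemma ae_sum_sqr_shift_cvg0 :
  {ae P, forall w, (fun m => \sum_i sqr_shift m i w)%R @ \oo --> 0%R}.
Proof.
apply: (@ae_cvg0_of_drift _ _ _ P state_energy _
  (shift_gain / n%:R) (n%:R ^+ 2 * k 0)).
- by rewrite divr_gt0 ?shift_gain_gt0// ltr0n.
- exact: measurable_state_energy.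
- exact: state_energy_bounds.
- by move=> m; apply: measurable_sum => i; exact: measurable_sqr_shift.
- by move=> m w; apply: sumr_ge0 => i _; exact: sqr_ge0.
- by move=> m; apply: le_trans (expectation_rescale m); exact: expectation_move.
Qed.

Lemma ae_mean_shift_vector_cvg0 : {ae P, forall w, forall i, (fun m =>
  eucnorm (mean_shift_vector k (bandwidth m w) (state m w) i)) @ \oo --> 0%R}.
Proof.
apply: filterS ae_sum_sqr_shift_cvg0 => w sum_cvg0 i.
have sqr_cvg0 : sqr_shift ^~ i ^~ w @ \oo --> 0%R.
  apply: squeeze_cvgr (cvg_cst 0%R) sum_cvg0; near=> m.
  rewrite sqr_ge0/= (bigD1 i)//= lerDl.
  by apply: sumr_ge0 => j _; exact: sqr_ge0.
rewrite (_ : (fun m => _) = Num.sqrt \o (sqr_shift ^~ i ^~ w)).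
  by rewrite -sqrtr0; apply: continuous_cvg sqr_cvg0; exact: sqrt_continuous.
by apply/funext => m /=; rewrite /sqr_shift sqrtr_sqr ger0_norm ?eucnorm_ge0.
Unshelve. all: by end_near. Qed.

End Process.

Theorem theorem2 (R : realType) (dT : measure_display) (T : measurableType dT)
    (P : probability T R) (n d : nat) (k : R -> R) (hmin hmax h1 tau : R)
    (nu : nat -> R) (X0 : 'I_n -> 'rV[R]_d)
    (I : nat -> T -> 'I_n) (U : nat -> T -> R) :
  (0 < n)%N -> (0 < d)%N ->
  is_profile k ->
  0 < hmin -> hmin < hmax ->
  hmin <= h1 -> h1 <= hmax ->
  (forall m, 0 <= nu m) -> nu @ \oo --> 0 ->
  0 < tau -> tau < hmin / 2 ->
  dsms_noise P I U ->
  {ae P, forall w,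
    let X := dsms_state k hmin hmax h1 nu (fun m => U m w) (fun m => I m w) X0 in
    exists (M : nat) (c : 'I_n -> 'I_M),
      (forall l : 'I_M, exists i, c i = l) /\
      (exists K : nat, forall m, (K <= m)%N ->
         (forall i j, c i = c j -> eucdist (X m i) (X m j) < tau) /\
         (forall i j, c i <> c j -> hmin - tau < eucdist (X m i) (X m j))) /\
      (forall i j, c i = c j ->
         (fun m => eucdist (X m i) (X m j)) @ \oo --> 0)}.
Proof.
move=> n_gt0 _ profile_k hmin_gt0 hmin_lt h1_ge h1_le nu_ge0 _ tau_gt0 tau_lt noise.
have h1_bounds : hmin <= h1 <= hmax by rewrite h1_ge.
have shifts_cvg0 := ae_mean_shift_vector_cvg0 X0 n_gt0 profile_k hmin_gt0 hmin_lt
  h1_bounds nu_ge0 noise.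
apply: filterS2 (ae_cutoff_noise n_gt0 noise) shifts_cvg0 => w cutoffE shift_cvg0 /=.
have -> : U ^~ w = cut_noise U ^~ w by apply/funext => m; rewrite /cut_noise cutoffE.
apply: (vanishing_shifts_clusters profile_k hmin_gt0 tau_gt0 tau_lt _ _ _ shift_cvg0).
- by move=> m; exact: bandwidth_bounds.
- by move=> m; exact: dsms_stateS.
- by move=> m i; exact: eucnorm_dsms_state_le.
Qed.
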